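(* Let $f:\mathbb{R}^d\to\mathbb{R}$ be differentiable with $\|\nabla f(x)-\nabla f(y)\|\le L\|x-y\|$ for all $x,y$, and let $f^{\ast}=\min_x f(x)$. Run SGDM with bandwidth-based step-size (see context) on $f$ with momentum parameter $\beta\in(0,1)$, with a stochastic gradient oracle which, for any input vector, returns a vector $g$ with $\mathbb{E}[\|g\|^2]\le G^2$. Assume that there exists a constant $\Delta_0$ such that $\mathbb{E}[f(x_i^t)-f^{\ast}]\le\Delta_0$ for $t,i\ge 1$, that the step-size in each stage is monotonically decreasing (i.e. $\eta_i^t\le\eta_{i-1}^t$ for $2\le i\le S_t$), and that $\eta_i^t\le 1/L$. Let the total number of iterations $T\ge 1$ be given, and let $N\ge 1$, $S_t=S=T/N$ and $\delta(t)=1/\alpha^{t-1}$ for each $1\le t\le N$, with $\alpha>1$. Then $$\mathbb{E}[\|\nabla f(\hat{x}_T)\|^2]\le\frac{W_1^1\cdot N}{T\alpha^{N-1}}+(\alpha C_0+C_2)\cdot\frac{N}{T}+\frac{\Delta_z+C_1}{m}\cdot\frac{N\alpha^N}{T}+MB_1G^2\cdot\frac{N}{\alpha^{N-1}},$$ where $$r=\frac{\beta L}{2(1-\beta^2)(1-\beta)^2},\quad \Delta_z=\frac{\Delta_0}{1-\beta}+\frac{\beta G^2}{2(1-\beta)^2L},\quad A_1=\frac{\beta\Delta_0}{1-\beta}+\Delta_z+\frac{rG^2}{L^2},\quad A_2=1+\frac{\beta}{2(1-\beta)^2},$$ $$B_1=r(1-\beta)(2-\beta)+\frac{L}{2(1-\beta)^2},\quad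 C_0=r\Big(\frac{G^2}{L}+2\Delta_0\Big),\quad C_1=A_1+\Delta_z+\frac{\Delta_0}{1-\beta},\quad C_2=C_0+A_2G^2,$$ and $W_1^1$ is defined in the context. Furthermore, if $N=(\log_\alpha T)/2$ and $S_t=2T/\log_\alpha T$ for each $1\le t\le N$, where $\alpha>1$, then $$\mathbb{E}[\|\nabla f(\hat{x}_T)\|^2]\le\frac{\alpha W_1^1}{2\ln\alpha}\frac{\ln T}{T^{3/2}}+\frac{\alpha C_0+C_2}{2\ln\alpha}\frac{\ln T}{T}+\frac{\Delta_z+C_1}{2m\ln\alpha}\frac{\ln T}{\sqrt{T}}+\frac{\alpha MB_1G^2}{2\ln\alpha}\frac{\ln T}{\sqrt{T}}.$$
   Context: SGDM with bandwidth-based step-size. Inputs: an initial point $x_1^1\in\mathbb{R}^d$ and $v_1^1=0$; the number of iterations $T$, the number of stages $N$ and stage lengths $S_1,\dots,S_N$ with $\sum_{t=1}^N S_t=T$; $\beta\in(0,1)$; constants $0<m\le M$; a positive monotonically decreasing boundary function $\delta$ with $\delta(1)=1$; and numbers $n(t,i)\in[m,M]$ for $1\le t\le N$, $1\le i\le S_t$. For $t=1,\dots,N$ and $i=1,\dots,S_t$: the algorithm queries the stochastic gradient oracle at $x_i^t$, receiving a vector $g_i^t$ with $\mathbb{E}[g_i^t\mid\mathcal{F}_i^t]=\nabla f(x_i^t)$; sets the step-size $\eta_i^t=n(t,i)\delta(t)$; and sets $v_{i+1}^t=\beta v_i^t+(1-\beta)g_i^t$, $x_{i+1}^t=x_i^t-\eta_i^t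 v_{i+1}^t$. At the end of stage $t$, $v_1^{t+1}=v_{S_t+1}^t$ and $x_1^{t+1}=x_{S_t+1}^t$. Here $\mathcal{F}_i^t$ is the $\sigma$-algebra formed by all the random information before the current iterate $x_i^t$, and $x_i^t$ is $\mathcal{F}_i^t$-measurable. Output: an integer $t^{\ast}\in\{1,\dots,N\}$ is chosen randomly with probability $P_t=\delta(t)^{-1}/\sum_{l=1}^N\delta(l)^{-1}$, and then $\hat{x}_T$ is chosen uniformly from $\{x_1^{t^\ast},\dots,x_{S_{t^\ast}}^{t^\ast}\}$. Definition of $W$: with $z_i^t=(1-\beta)^{-1}(x_i^t-\beta x_{i-1}^t)$, $$W_{i+1}^t=\frac{f(z_{i+1}^t)-f^{\ast}}{\eta_i^t}+\frac{r\|x_{i+1}^t-x_i^t\|^2}{\eta_i^t}+2r[f(x_{i+1}^t)-f^{\ast}].$$ $W_1^1$ is this expression for $t=1$, $i=0$. It involves a step-size $\eta_0^1>0$ and a point $x_0^1$ preceding the first iteration, related by $x_1^1=x_0^1-\eta_0^1v_1^1$ (so $x_0^1=x_1^1$, since $v_1^1=0$); no particular value of $\eta_0^1$ is prescribed. *)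

(* Defs.v *)
From HB Require Import structures.
From mathcomp Require Import all_boot all_order all_algebra.
From mathcomp Require Import all_classical all_reals all_analysis.
Set Implicit Arguments.
Unset Strict Implicit.
Unset Printing Implicit Defensive.
Import Order.TTheory GRing.Theory Num.Theory.
Import numFieldNormedType.Exports.
Local Open Scope classical_set_scope.
Local Open Scope ring_scope.

(* The library norm `|x| on 'rV[R]_d is the sup norm. *)
Definition l2norm (R : realType) (d : nat) (x : 'rV[R]_d) : R :=
  Num.sqrt (\sum_(j < d) x 0 j ^+ 2).

Definition grad (R : realType) (d : nat) (f : 'rV[R]_d -> R)
    (x : 'rV[R]_d) : 'rV[R]_d :=
  \row_(j < d) 'D_(delta_mx 0 j) f x.

Definition measurable_wrt (R : realType) (Omega : Type)
    (G : set (set Omega)) (X : Omega -> R) : Prop :=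
  preimage_set_system [set: Omega] X measurable `<=` G.

Definition vmeasurable_wrt (R : realType) (d : nat) (Omega : Type)
    (G : set (set Omega)) (X : Omega -> 'rV[R]_d) : Prop :=
  forall j, measurable_wrt G (fun w => X w 0 j).

(* Y is a version of E[X | G]. *)
Definition is_cond_expectation (R : realType) (disp : measure_display)
    (Omega : measurableType disp) (P : probability Omega R)
    (G : set (set Omega)) (X Y : Omega -> R) : Prop :=
  [/\ P.-integrable setT (EFin \o X), P.-integrable setT (EFin \o Y),
      measurable_wrt G Y &
      forall A, G A ->
        (\int[P]_(w in A) (X w)%:E = \int[P]_(w in A) (Y w)%:E)%E].

Definition is_vcond_expectation (R : realType) (d : nat)
    (disp : measure_display) (Omega : measurableType disp)
    (P : probability Omega R) (G : set (set Omega))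
    (X Y : Omega -> 'rV[R]_d) : Prop :=
  forall j, is_cond_expectation P G (fun w => X w 0 j) (fun w => Y w 0 j).

Record boundary_function (R : realType) (N : nat) (delta : nat -> R) : Prop := {
  bf_one : delta 1%N = 1;
  bf_gt0 : forall t, (1 <= t <= N)%N -> 0 < delta t;
  bf_decr : forall s t, (1 <= s)%N -> (s <= t <= N)%N -> delta t <= delta s }.

Definition stepsize (R : realType) (n : nat -> nat -> R) (delta : nat -> R)
    (t i : nat) : R := n t i * delta t.

(* The sub-sigma-algebra F t i is the information available before x_i^t; it is
   indexed up to i = (S t).+1, so that F N (S N).+1 is the information of the
   whole run. *)
Record run_filtration (R : realType) (d : nat) (disp : measure_display)
    (Omega : measurableType disp) (N : nat) (S : nat -> nat)
    (F : nat -> nat -> set (set Omega))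
    (x g : nat -> nat -> Omega -> 'rV[R]_d) : Prop := {
  rf_sigma : forall t i, (1 <= t <= N)%N -> (1 <= i <= (S t).+1)%N ->
    sigma_algebra setT (F t i) /\ F t i `<=` measurable;
  rf_mono : forall t i, (1 <= t <= N)%N -> (1 <= i <= S t)%N ->
    F t i `<=` F t i.+1;
  rf_next : forall t, (1 <= t < N)%N -> F t (S t).+1 `<=` F t.+1 1%N;
  rf_iterate : forall t i, (1 <= t <= N)%N -> (1 <= i <= S t)%N ->
    vmeasurable_wrt (F t i) (x t i);
  rf_oracle : forall t i, (1 <= t <= N)%N -> (1 <= i <= S t)%N ->
    vmeasurable_wrt (F t i.+1) (g t i) }.

Record sgdm_run (R : realType) (d : nat) (disp : measure_display)
    (Omega : measurableType disp) (P : probability Omega R)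
    (f : 'rV[R]_d -> R) (beta m M : R) (delta : nat -> R)
    (T N : nat) (S : nat -> nat) (n : nat -> nat -> R) (x11 : 'rV[R]_d)
    (F : nat -> nat -> set (set Omega))
    (x v g : nat -> nat -> Omega -> 'rV[R]_d) : Prop := {
  run_total : (\sum_(1 <= t < N.+1) S t)%N = T;
  run_beta : 0 < beta < 1;
  run_mM : 0 < m <= M;
  run_delta : boundary_function N delta;
  run_band : forall t i, (1 <= t <= N)%N -> (1 <= i <= S t)%N ->
    m <= n t i <= M;
  run_x11 : forall w, x 1%N 1%N w = x11;
  run_v11 : forall w, v 1%N 1%N w = 0;
  run_filtr : run_filtration N S F x g;
  run_unbiased : forall t i, (1 <= t <= N)%N -> (1 <= i <= S t)%N ->
    is_vcond_expectation P (F t i) (g t i) (fun w => grad f (x t i w));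
  run_v : forall t i w, (1 <= t <= N)%N -> (1 <= i <= S t)%N ->
    v t i.+1 w = beta *: v t i w + (1 - beta) *: g t i w;
  run_x : forall t i w, (1 <= t <= N)%N -> (1 <= i <= S t)%N ->
    x t i.+1 w = x t i w - stepsize n delta t i *: v t i.+1 w;
  run_v_next : forall t w, (1 <= t < N)%N -> v t.+1 1%N w = v t (S t).+1 w;
  run_x_next : forall t w, (1 <= t < N)%N -> x t.+1 1%N w = x t (S t).+1 w }.

Definition stage_prob (R : realType) (N : nat) (delta : nat -> R)
    (t : nat) : R :=
  (delta t)^-1 / \sum_(1 <= l < N.+1) (delta l)^-1.

(* The output is x_(istar)^(tstar): "uniformly from {x_1, ..., x_S}" is uniform
   choice of the index istar, and the pair (tstar, istar) is drawn independently
   of the run, whose sigma-algebra is G. *)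
Record output_index (R : realType) (disp : measure_display)
    (Omega : measurableType disp) (P : probability Omega R)
    (delta : nat -> R) (N : nat) (S : nat -> nat) (G : set (set Omega))
    (tstar istar : {RV P >-> nat}) : Prop := {
  out_stage_range : forall w, (1 <= tstar w <= N)%N;
  out_iter_range : forall w, (1 <= istar w <= S (tstar w))%N;
  out_stage : forall t, (1 <= t <= N)%N ->
    P (tstar @^-1` [set t]) = (stage_prob N delta t)%:E;
  out_iter : forall t i, (1 <= t <= N)%N -> (1 <= i <= S t)%N ->
    P (tstar @^-1` [set t] `&` istar @^-1` [set i]) =
      (P (tstar @^-1` [set t]) * ((S t)%:R^-1)%:E)%E;
  out_indep : forall t i A, G A ->
    P (tstar @^-1` [set t] `&` istar @^-1` [set i] `&` A) =
      (P (tstar @^-1` [set t] `&` istar @^-1` [set i]) * P A)%E }.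

Definition zpoint (R : realType) (d : nat) (beta : R)
    (xprev xcur : 'rV[R]_d) : 'rV[R]_d :=
  (1 - beta)^-1 *: (xcur - beta *: xprev).

(* W_{i+1}^t is Wfun at eta = eta_i^t, xprev = x_i^t, xcur = x_{i+1}^t. *)
Definition Wfun (R : realType) (d : nat) (f : 'rV[R]_d -> R)
    (fstar beta r eta : R) (xprev xcur : 'rV[R]_d) : R :=
  (f (zpoint beta xprev xcur) - fstar) / eta
  + r * l2norm (xcur - xprev) ^+ 2 / eta
  + 2 * r * (f xcur - fstar).

(* Main.v *)
(* Put c = beta / (1 - beta).  Within a stage, consider the auxiliary point
   z_i = x_i - c eta_i v_i, built with the current step-size.  Since
   x_(i+1) - c eta_i v_(i+1) = z_i - eta_i g_i, it performs a plain stochastic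
   gradient step, so the descent lemma bounds E |grad f(x_i)|^2 by the decrease
   of E f(z_i) / eta_i plus (L c + L / 2) eta_i G^2; here Lipschitz continuity
   is used to compare <grad f(z_i), grad f(x_i)> with |grad f(x_i)|^2.
   Replacing eta_i by eta_(i+1) <= eta_i in the auxiliary point costs at most
   (1 / eta_(i+1) - 1 / eta_i) Delta_z.  Every stage therefore telescopes on its
   own, to Delta_z / eta_S + (L c + L / 2) G^2 \sum_i eta_i, and averaging over
   the stages with weights proportional to alpha^(t-1) gives a bound dominated
   by the third and fourth terms of the theorem, because L c + L / 2 <= B_1; the
   other terms are nonnegative. *)
Require Import Defs.
From HB Require Import structures.
From mathcomp Require Import all_boot all_order all_algebra.
From mathcomp Require Import all_classical all_reals all_analysis.
From mathcomp Require Import measurable_realfun ring lra.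
Set Implicit Arguments.
Unset Strict Implicit.
Unset Printing Implicit Defensive.
Import Order.TTheory GRing.Theory Num.Theory.
Import numFieldNormedType.Exports.
Local Open Scope classical_set_scope.
Local Open Scope ring_scope.

(** * Euclidean inner product of row vectors *)

Section dot_product.
Context {R : realType} {d : nat}.
Implicit Types (u v w : 'rV[R]_d) (k : R).

(** Squared Euclidean norms are written [dot u u] from here on, which keeps square roots out of the
    estimates. *)
Definition dot u v : R := \sum_(j < d) u 0 j * v 0 j.

Lemma dotC u v : dot u v = dot v u.
Proof. by apply: eq_bigr => j _; rewrite mulrC. Qed.

Lemma dotDl u v w : dot (u + v) w = dot u w + dot v w.
Proof. by rewrite -big_split; apply: eq_bigr => j _; rewrite mxE mulrDl. Qed.

Lemma dotZl k u v : dot (k *: u) v = k * dot u v.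
Proof. by rewrite mulr_sumr; apply: eq_bigr => j _; rewrite mxE mulrA. Qed.

Lemma dotNl u v : dot (- u) v = - dot u v.
Proof. by rewrite -scaleN1r dotZl mulN1r. Qed.

Lemma dotDr u v w : dot w (u + v) = dot w u + dot w v.
Proof. by rewrite dotC dotDl !(dotC w). Qed.

Lemma dotZr k u v : dot u (k *: v) = k * dot u v.
Proof. by rewrite dotC dotZl dotC. Qed.

Lemma dotNr u v : dot u (- v) = - dot u v.
Proof. by rewrite dotC dotNl dotC. Qed.

Lemma dotvv_ge0 u : 0 <= dot u u.
Proof. by apply: sumr_ge0 => j _; rewrite -expr2 sqr_ge0. Qed.

Lemma sqr_l2norm u : l2norm u ^+ 2 = dot u u.
Proof.
rewrite sqr_sqrtr; last by apply: sumr_ge0 => j _; exact: sqr_ge0.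
by apply: eq_bigr => j _; rewrite expr2.
Qed.

Lemma sqr_coord_le_dotvv u j : u 0 j ^+ 2 <= dot u u.
Proof.
by rewrite /dot (bigD1 j)//= expr2 lerDl sumr_ge0// => i _; rewrite -expr2 sqr_ge0.
Qed.

(** Expanding [|k u - v|^2 >= 0] and dividing by [k] gives this weighted inequality. It takes the
    place of Cauchy-Schwarz below, with [k] chosen to balance the two squares. *)
Lemma dot_young k u v : 0 < k -> 2 * dot u v <= k * dot u u + k^-1 * dot v v.
Proof.
move=> k0; have := dotvv_ge0 (k *: u - v).
rewrite !(dotDl, dotDr, dotNl, dotNr, dotZl, dotZr) (dotC v u) => h.
rewrite -(ler_pM2l k0) mulrDr [k * (k^-1 * _)]mulrA mulfV ?gt_eqF// mul1r.
by lra.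
Qed.

End dot_product.

(** * Quadratic upper bound from a Lipschitz gradient *)

Section smooth.
Context {R : realType} {d : nat}.
Implicit Types (f : 'rV[R]_d -> R) (x y z u v : 'rV[R]_d).

Lemma derive_grad f x v : differentiable f x -> 'D_v f x = dot (grad f x) v.
Proof.
move=> df; rewrite deriveE// [in LHS](row_sum_delta v) linear_sum.
by apply: eq_bigr => j _; rewrite linearZ/= mxE deriveE// mulrC.
Qed.

(** The difference quotient of the restriction to the line at [s] is the directional difference
    quotient of [f] at [x + s v]. *)
Lemma is_derive_line f (g : 'rV[R]_d -> 'rV[R]_d) x v (s : R) :
  (forall y, is_derive y v f (dot (g y) v)) ->
  is_derive s 1 (fun t : R => f (x + t *: v)) (dot (g (x + s *: v)) v).
Proof.
move=> /(_ (x + s *: v)) h.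
have E : (fun t : R => t^-1 *:
    (((fun t : R => f (x + t *: v)) \o shift s) (t *: 1) - f (x + s *: v))) =
  (fun t : R => t^-1 *: ((f \o shift (x + s *: v)) (t *: v) - f (x + s *: v))).
  apply/funext => t /=; congr (_ *: (f _ - _)).
  by rewrite /shift [t *: 1]mulr1 scalerDl addrCA.
split; first by rewrite /derivable E; exact: ex_derive.
by rewrite /derive E; exact: derive_val.
Qed.

(* The function [s |-> f (x + s v) - s <g x, v> - L s^2 |v|^2 / 2] is
   nonincreasing on [0, 1]. *)
Lemma smooth_le f (g : 'rV[R]_d -> 'rV[R]_d) (L : R) : 0 < L ->
  (forall x v, is_derive x v f (dot (g x) v)) ->
  (forall x y, dot (g x - g y) (g x - g y) <= L ^+ 2 * dot (x - y) (x - y)) ->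
  forall x v, f (x + v) <= f x + dot (g x) v + L / 2 * dot v v.
Proof.
move=> L0 df lip x v.
pose h (s : R) := f (x + s *: v) - (s * dot (g x) v + L / 2 * dot v v * s ^+ 2).
have dh (s : R) : is_derive s 1 h
    (dot (g (x + s *: v)) v - (dot (g x) v + L * dot v v * s)).
  have /= D1 := @is_derive_line f g x v s (fun y => df y v).
  apply: is_derive_eq; move: (dot (g _) v) => a; rewrite /GRing.scale/=; by field.
have hc : {within `[0, 1], continuous h}.
  apply: continuous_subspaceT => y; have [hy _] := dh y.
  exact/differentiable_continuous/derivable1_diffP.
have := @ler0_derive1_nincr R h 0 1 _ _ hc 0 1 (lexx _) ler01 (lexx _).
rewrite /h scale1r scale0r addr0 !mul0r expr0n/= mulr0 addr0 subr0 expr1n.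
rewrite mul1r mulr1 => H.
suff : f (x + v) - (dot (g x) v + L / 2 * dot v v) <= f x by lra.
apply: H => s; rewrite in_itv/= => /andP[s0 s1]; first by case: (dh s).
rewrite derive1E (@derive_val _ _ _ _ _ _ _ (dh s)).
have Ls0 : 0 < L * s by rewrite mulr_gt0.
(* The weight [1 / (L s)] balances the Lipschitz bound [|g (x + s v) - g x|^2 <= (L s)^2 |v|^2], so
   that both squares become [L s |v|^2]. *)
have := dot_young (g (x + s *: v) - g x) v (k := (L * s)^-1).
rewrite invr_gt0 invrK => /(_ Ls0).
have := lip (x + s *: v) x; rewrite [_ - x]addrAC subrr add0r !(dotZl, dotZr).
rewrite [dot (_ - _) v]dotDl [dot (- _) v]dotNl => h1 h2.
have : (L * s)^-1 * dot (g (x + s *: v) - g x) (g (x + s *: v) - g x) <=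
    (L * s) * dot v v.
  rewrite mulrC ler_pdivrMr//; apply: (le_trans h1).
  by rewrite le_eqVlt; apply/orP; left; apply/eqP; ring.
by move=> h3; lra.
Qed.

End smooth.

(** * Pointwise inequalities for a smooth function bounded below *)

Section lsmooth_function.
Context {R : realType} {d : nat} (f : 'rV[R]_d -> R) (L fstar : R).
Hypothesis hf_diff : forall x, differentiable f x.
Hypothesis hL : 0 < L.
Hypothesis hf_lip :
  forall x y, l2norm (grad f x - grad f y) <= L * l2norm (x - y).
Hypothesis hfstar : forall x, fstar <= f x.
Implicit Types (x v g : 'rV[R]_d) (c e : R).

Lemma grad_lipschitz_dot x y :
  dot (grad f x - grad f y) (grad f x - grad f y) <= L ^+ 2 * dot (x - y) (x - y).
Proof.
rewrite -!sqr_l2norm -exprMn lerXn2r// nnegrE ?sqrtr_ge0//.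
by rewrite mulr_ge0 ?sqrtr_ge0// ltW.
Qed.

Lemma grad_coord_continuous j : continuous (fun x => grad f x 0 j).
Proof.
move=> x; apply/(@cvgrPdist_le _ R^o _ (nbhs x)) => e e0.
(* Balls are taken in the sup norm, so the Euclidean bound costs a factor depending on the
   dimension; [d.+1] keeps it positive when [d = 0]. *)
have Ld0 : 0 < L * d.+1%:R by rewrite mulr_gt0.
apply/nbhs_ballP; exists (e / (L * d.+1%:R)) => [|y [_ xy]].
  by rewrite /= divr_gt0.
rewrite -(@ler_pXn2r _ 2)// ?nnegrE ?(ltW e0)// -normrX ger0_norm ?sqr_ge0//.
have -> : grad f x 0 j - grad f y 0 j = (grad f x - grad f y) 0 j.
  by rewrite [RHS]mxE [X in _ = _ + X]mxE.
apply: le_trans (sqr_coord_le_dotvv _ j) (le_trans (grad_lipschitz_dot x y) _).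
(* The target is written as a sum with one more term than there are coordinates, so that it can be
   compared coordinate by coordinate and the last term dropped. *)
have -> : e ^+ 2 = L ^+ 2 * (\sum_(i < d.+1) (d.+1%:R * (e / (L * d.+1%:R)) ^+ 2)).
  rewrite sumr_const card_ord -[_ *+ _]mulr_natl.
  have : 0 < d.+1%:R :> R by [].
  by move: (d.+1%:R) => D D0; field; rewrite !gt_eqF.
rewrite ler_pM2l ?exprn_gt0// big_ord_recr/= -[leLHS]addr0 lerD//; last first.
  by rewrite mulr_ge0// sqr_ge0.
apply: ler_sum => i _; rewrite -expr2 -[leLHS]mul1r ler_pM ?sqr_ge0 ?ler1n//.
rewrite -[leLHS]ger0_norm ?sqr_ge0// normrX lerXn2r ?nnegrE// ?divr_ge0 ?ltW//.
by rewrite !mxE; have := xy 0 i; rewrite /ball/=.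
Qed.

Lemma is_derive_grad x v : is_derive x v f (dot (grad f x) v).
Proof. by rewrite -derive_grad//; exact/derivableP/diff_derivable. Qed.

Lemma descent_le x v : f (x + v) <= f x + dot (grad f x) v + L / 2 * dot v v.
Proof. exact: smooth_le hL is_derive_grad grad_lipschitz_dot x v. Qed.

Lemma gradient_step_le x g e :
  f (x - e *: g) - fstar <=
  f x - fstar - e * dot (grad f x) g + L / 2 * e ^+ 2 * dot g g.
Proof.
have := descent_le x (- e *: g); rewrite scaleNr !(dotNl, dotNr, dotZl, dotZr).
by rewrite opprK expr2 -!mulrA; lra.
Qed.

(** This is the quadratic upper bound for [- f], whose gradient has the same Lipschitz constant. *)
Lemma descent_ge x v : f x + dot (grad f x) v - L / 2 * dot v v <= f (x + v).
Proof.
have dN y u : is_derive y u (- f) (dot (- grad f y) u).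
  by rewrite dotNl; apply: is_deriveN; exact: is_derive_grad.
have := smooth_le hL dN _ x v; rewrite dotNl !fctE => h.
suff : - f (x + v) <= - f x - dot (grad f x) v + L / 2 * dot v v by lra.
apply: h => y z; rewrite opprK addrC -opprB dotNl dotNr opprK.
exact: grad_lipschitz_dot.
Qed.

(** A gradient step of length [1 / L] decreases [f] by at least [|grad f x|^2 / (2 L)] and cannot go
    below [fstar]. *)
Lemma sqr_grad_le x : dot (grad f x) (grad f x) <= 2 * L * (f x - fstar).
Proof.
have := le_trans (hfstar _) (descent_le x (- L^-1 *: grad f x)).
rewrite !(dotZl, dotZr); set q := dot _ _ => h.
have -> : q = 2 * L * (L^-1 * q - L / 2 * (- L^-1 * (- L^-1 * q))).
  by field; rewrite gt_eqF.
by rewrite ler_pM2l ?mulr_gt0//; lra.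
Qed.

(** The upper bound at [x - c e v] contains [- c e <grad f x, v>], of unknown sign. It cancels
    against [c] times the upper bound at [x + e v], which is at least [fstar]. *)
Lemma momentum_point_le x v c e : 0 <= c ->
  f (x - (c * e) *: v) - fstar <=
  (1 + c) * (f x - fstar) + (c + c ^+ 2) * (L * e ^+ 2 / 2) * dot v v.
Proof.
move=> c0; have h1 := descent_le x (- (c * e) *: v).
have h2 : 0 <= c *
    (f x - fstar + e * dot (grad f x) v + L / 2 * (e * (e * dot v v))).
  rewrite mulr_ge0//; have := le_trans (hfstar _) (descent_le x (e *: v)).
  by rewrite !(dotZl, dotZr); lra.
rewrite -scaleNr; apply: (le_trans (lerB h1 (lexx _))).
rewrite -subr_ge0; apply: le_trans h2 _; rewrite !(dotZl, dotZr).
by rewrite le_eqVlt; apply/orP; left; apply/eqP; field.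
Qed.

(* The point for [e2] lies on the segment from [x] to the point for [e1], on
   which an [L]-smooth function exceeds the chord by a quadratic error only. *)
Lemma stepsize_change_le x v c e1 e2 : 0 < e2 -> e2 <= e1 -> e1 <= 1 / L ->
  (f (x - (c * e2) *: v) - fstar) / e2 <=
  (f (x - (c * e1) *: v) - fstar) / e1 +
  (e2^-1 - e1^-1) * (f x - fstar + c ^+ 2 / (2 * L) * dot v v).
Proof.
move=> e20 e21 e1L; have e10 : 0 < e1 by exact: lt_le_trans e21.
set y := x - (c * e2) *: v.
have h1 := descent_ge y ((c * e2) *: v).
have h2 := descent_ge y ((c * (e2 - e1)) *: v).
have E1 : y + (c * e2) *: v = x by rewrite /y subrK.
have E2 : y + (c * (e2 - e1)) *: v = x - (c * e1) *: v.
  by rewrite /y mulrBr scalerBl addrA subrK.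
rewrite E1 in h1; rewrite E2 in h2; move: h1 h2; rewrite !(dotZl, dotZr).
set a := f (x - (c * e1) *: v); set b := f x; set q := dot v v; set p := dot _ v.
move=> h1 h2; have q0 : 0 <= q by exact: dotvv_ge0.
rewrite -(ler_pM2l (mulr_gt0 e10 e20)).
(* The weights [e1 - e2] and [e2] make the two inner products with [grad f y] cancel. *)
have H : 0 <= (e1 - e2) *
    (b - (f y + c * e2 * p - L / 2 * (c * e2 * (c * e2 * q)))) +
   e2 * (a - (f y + c * (e2 - e1) * p -
     L / 2 * (c * (e2 - e1) * (c * (e2 - e1) * q)))).
  by apply: addr_ge0; apply: mulr_ge0; rewrite ?subr_ge0//; exact: ltW.
(* The quadratic error is [(e1 - e2) e1 e2 L c^2 |v|^2 / 2]; the bound [1 / L] on both step-sizes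
   turns it into the term with [c^2 / (2 L)]. *)
have Lee : L ^+ 2 * (e1 * e2) <= 1.
  have Le1 : L * e1 <= 1 by move: e1L; rewrite ler_pdivlMr// mulrC.
  have Le2 : L * e2 <= 1 by apply: le_trans Le1; rewrite ler_pM2l.
  by rewrite expr2 mulrACA mulr_ile1// ltW// mulr_gt0.
have K : 0 <= (1 - L ^+ 2 * (e1 * e2)) * ((e1 - e2) * (c ^+ 2 * q) / (2 * L)).
  apply: mulr_ge0; rewrite ?subr_ge0//; apply: divr_ge0.
    by apply: mulr_ge0; rewrite ?subr_ge0//; apply: mulr_ge0 => //; exact: sqr_ge0.
  by rewrite mulr_ge0// ltW.
rewrite -subr_ge0; apply: le_trans (addr_ge0 H K) _.
rewrite le_eqVlt; apply/orP; left; apply/eqP; field.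
by rewrite !gt_eqF.
Qed.

(** The left side is [- <grad f z - grad f x, grad f x>] with [|z - x| = c e |v|]. The weight
    [1 / (L c e)] in [dot_young] splits the cost evenly between [|v|^2] and [|grad f x|^2]. *)
Lemma cross_grad_le x v c e : 0 < c -> 0 < e ->
  dot (grad f x) (grad f x) - dot (grad f (x - (c * e) *: v)) (grad f x) <=
  L * (c * e) / 2 * (dot v v + dot (grad f x) (grad f x)).
Proof.
move=> c0 e0; set z := x - _; have ce0 : 0 < c * e by rewrite mulr_gt0.
have Lce0 : 0 < L * (c * e) by rewrite mulr_gt0.
have := dot_young (- (grad f z - grad f x)) (grad f x) (k := (L * (c * e))^-1).
rewrite invr_gt0 invrK => /(_ Lce0); have := grad_lipschitz_dot z x.
have -> : z - x = - (c * e) *: v by rewrite /z addrAC subrr add0r scaleNr.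
rewrite [dot (- _ *: _) _]dotZl dotZr dotNl [dot (- _) (- _)]dotNl dotNr opprK.
rewrite [dot (_ - _) (grad f x)]dotDl [dot (- grad f x) (grad f x)]dotNl.
move=> h1 h2.
have : (L * (c * e))^-1 * dot (grad f z - grad f x) (grad f z - grad f x) <=
    (L * (c * e)) * dot v v.
  rewrite mulrC ler_pdivrMr//; apply: (le_trans h1).
  by rewrite le_eqVlt; apply/orP; left; apply/eqP; ring.
by move=> h3; lra.
Qed.

End lsmooth_function.

(** * Continuous functions of random vectors *)

Section measurability.
Context {R : realType} {d : nat}.

(** Second countability of the space reduces the claim to coordinates: an open set is a countable
    union of rational boxes, and the preimage of a box is a finite intersection of coordinate
    conditions. *)
Lemma measurable_continuous_rV {disp : measure_display} {T : measurableType disp}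
    (f : 'rV[R]_d -> R) (X : T -> 'rV[R]_d) :
  continuous f -> (forall j, measurable_fun setT (fun w => X w 0 j)) ->
  measurable_fun setT (f \o X).
Proof.
move=> cf mX; apply: (measurability (@RGenOpens.G R)).
  exact: RGenOpens.measurableE.
move=> _ [_ [a [b ->]] <-].
rewrite setTI comp_preimage; set O := f @^-1` _.
have oO : open O by apply: open_comp; [move=> x _; exact: cf|exact: interval_open].
pose box (q : 'rV[rat]_d * nat) : set 'rV[R]_d :=
  [set y | forall j, `|ratr (q.1 0 j) - y 0 j| < q.2.+1%:R^-1].
(* Boxes not contained in [O] contribute the empty set, so the union can range over a whole
   countable type. *)
pose C q : set T := if `[< box q `<=` O >] then X @^-1` box q else set0.
(* [O] is a countable union of boxes with rational centers and sizes. *)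
have -> : X @^-1` O = \bigcup_q C q.
  rewrite eqEsubset; split => [w /= Ow|w [q _]]; last first.
    by rewrite /C; case: asboolP => // qO; exact: qO.
  have [e/= e0 eO] : exists2 e : R, 0 < e & ball (X w) e `<=` O.
    by apply/nbhs_ballP; exact: open_nbhs_nbhs.
  (* Two radii must fit into [e]: one from [X w] to the rational center, one from the center to any
     other point of the box. *)
  have [k ke] : exists k : nat, k.+1%:R^-1 + k.+1%:R^-1 < e :> R.
    have e20 : 0 < e / 2 by rewrite divr_gt0.
    exists (Num.truncn (e / 2)^-1).
    have : (Num.truncn (e / 2)^-1).+1%:R^-1 < e / 2.
      by rewrite invf_plt ?posrE// truncnS_gt.
    by move=> h; rewrite [ltRHS](splitr e) ltrD.
  have qP j : exists q : rat, `|ratr q - X w 0 j| < k.+1%:R^-1.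
    have [|q] := @rat_in_itvoo R (X w 0 j - k.+1%:R^-1) (X w 0 j + k.+1%:R^-1).
      by rewrite ltrBlDr -addrA ltrDl addr_gt0.
    rewrite in_itv/= => /andP[q1 q2]; exists q.
    by rewrite ltr_distl q1.
  pose q := \row_j sval (cid (qP j)).
  exists (q, k) => //; rewrite /C; case: asboolP => [_ j|[]] /=.
    by rewrite mxE; exact: (svalP (cid (qP j))).
  move=> y /= hy; apply: eO; split => // i j; rewrite (ord1 i) /ball/=.
  have h1 := svalP (cid (qP j)); have := hy j; rewrite mxE => h2.
  have -> : X w 0 j - y 0 j =
    (ratr (sval (cid (qP j))) - y 0 j) - (ratr (sval (cid (qP j))) - X w 0 j).
    by ring.
  by apply: le_lt_trans (ler_normB _ _) _; apply: lt_trans ke; rewrite ltrD.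
apply: countable_bigcupT_measurable => // q; rewrite /C; case: asboolP => // _.
have -> : X @^-1` box q = \bigcap_(j in [set: 'I_d])
    ((fun w => ratr (q.1 0 j) - X w 0 j) @^-1` (ball 0 (q.2.+1%:R^-1 : R))).
  rewrite eqEsubset; split => w /= h j.
    by move=> _; rewrite /ball/= sub0r normrN; exact: h.
  by have := h j I; rewrite /ball/= sub0r normrN.
apply: fin_bigcap_measurable => // j _; rewrite -[X in measurable X]setTI.
have mh : measurable_fun setT (fun w => ratr (q.1 0 j) - X w 0 j :> R).
  by apply: measurable_funB => //; exact: mX.
apply: mh => //.
by apply: open_measurable; exact: ball_open.
Qed.

End measurability.

(** * Factors measurable with respect to a sub-sigma-algebra *)

Section conditioning.
Import HBNNSimple.
Context {R : realType} {disp : measure_display} {Omega : measurableType disp}.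
Variables (P : probability Omega R) (G : set (set Omega)).
Hypotheses (sG : sigma_algebra setT G) (Gm : G `<=` measurable).

(** On the measurable type carried by [G], the closure properties of measurable functions become
    available for [measurable_wrt G]. *)
Lemma measurable_wrtP (X : Omega -> R) :
  measurable_wrt G X <-> measurable_fun setT (X : g_sigma_algebraType G -> R).
Proof.
have E : (measurable : set (set (g_sigma_algebraType G))) = G.
  exact: measurable_g_measurableTypeE.
split => [h _ B mB|h _ [B mB <-]]; first by rewrite E; apply: h; exists B.
by rewrite -E; exact: h.
Qed.

Lemma measurable_wrt_fun (X : Omega -> R) :
  measurable_wrt G X -> measurable_fun setT X.
Proof. by move=> h _ B mB; apply/Gm/h; exists B. Qed.

(** For a simple [Y] the integral is a finite combination of integrals of [D] over level sets of
    [Y], which lie in [G]. The general case follows by monotone approximation and dominated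
    convergence with bound [|Y D|]. *)
Lemma integral_mul_wrt_eq0_ge0 (Y D : Omega -> R) :
  measurable_wrt G Y -> (forall w, 0 <= Y w) ->
  P.-integrable setT (EFin \o D) ->
  (forall A, G A -> (\int[P]_(w in A) (D w)%:E = 0)%E) ->
  P.-integrable setT (EFin \o (Y \* D)) ->
  (\int[P]_w (Y w * D w)%:E = 0)%E.
Proof.
move=> /measurable_wrtP mY Y0 iD D0 iYD.
have E : (measurable : set (set (g_sigma_algebraType G))) = G.
  exact: measurable_g_measurableTypeE.
have mT : @measurable _ (g_sigma_algebraType G) setT by exact: measurableT.
have mYE : measurable_fun setT (EFin \o Y : g_sigma_algebraType G -> \bar R).
  exact/measurable_EFinP.
have Y0E x : setT x -> (0 <= (EFin \o Y) x)%E by rewrite lee_fin.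
(* The approximation is carried out over the type carrying [G], so the level sets of [s n] belong to
   [G]. *)
pose s n : Omega -> R := nnsfun_approx mT mYE n.
have sle n x : `|s n x| <= `|Y x|.
  have s0 : 0 <= s n x by exact: (fun_ge0 (s := nnsfun_approx mT mYE n)).
  rewrite (ger0_norm s0) ger0_norm//.
  by rewrite -lee_fin /s nnsfun_approxE; exact: le_approx.
have Gs n y : G (s n @^-1` [set y]).
  by rewrite -E; exact: (measurable_funPTI (nnsfun_approx mT mYE n)).
have ms n : measurable_fun setT (s n).
  apply: measurable_wrt_fun; apply/measurable_wrtP.
  exact: (measurable_funPT (nnsfun_approx mT mYE n)).
have scvg x : s ^~ x @ \oo --> Y x.
  have /fine_cvgP[_] := @cvg_nnsfun_approx _ _ _ _ mT _ mYE Y0E x I.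
  exact.
have mD : measurable_fun setT D by exact/measurable_EFinP/(measurable_int _ iD).
have s0 n : (\int[P]_w (s n w * D w)%:E = 0)%E.
  pose r := fset_set (range (s n)).
  have sE w : ((s n w * D w)%:E = \sum_(y <- finmap.enum_fset r)
      (y%:E * ((EFin \o D) \_ (s n @^-1` [set y])) w))%E.
    rewrite [s n w](fimfunE (nnsfun_approx mT mYE n)) fsbig_finite//=.
    rewrite mulr_suml -sumEFin; apply: eq_bigr => y _.
    by rewrite epatch_indic/= -EFinM -mulrA [D w * _]mulrC.
  have iy y : P.-integrable setT ((EFin \o D) \_ (s n @^-1` [set y])).
    have mA := Gm (Gs n y); apply/(integrable_mkcond _ mA).
    exact: integrableS iD.
  under eq_integral do rewrite sE.
  rewrite integral_sum//; last first.
    by move=> y; apply: integrableZl => //; exact: iy.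
  rewrite big1// => y _; rewrite integralZl//.
  by rewrite -integral_mkcond D0 ?mule0.
have [|||||_ _] := @dominated_convergence _ _ _ P setT measurableT
  (fun n w => (s n w * D w)%:E) (fun w => (Y w * D w)%:E)
  (fun w => `|(Y w * D w)%:E|)%E.
- move=> n; apply/measurable_EFinP; apply: measurable_funM => //; exact: ms.
- exact: measurable_int iYD.
- apply: aeW => x _; apply: cvg_EFin; first exact: nearW.
  by apply: cvgMl; exact: scvg.
- exact: integrable_abse.
- by apply: aeW => x n _; rewrite /= lee_fin !normrM ler_wpM2r.
under [X in X @ _ --> _ -> _]eq_fun do rewrite s0.
by move=> h; apply/esym; exact: cvg_unique (cvg_cst _) h.
Qed.

(** The pull-out property, from the preceding lemma with [D = X - X'] and the positive and negative
    parts of [Y]. Phrasing it by integrals over sets of [G] covers both conditional expectations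
    and, with [X] an indicator and [X'] a constant, independence from [G]. *)
Lemma integral_mul_wrt_eq (Y X X' : Omega -> R) :
  measurable_wrt G Y ->
  P.-integrable setT (EFin \o X) -> P.-integrable setT (EFin \o X') ->
  (forall A, G A ->
    (\int[P]_(w in A) (X w)%:E = \int[P]_(w in A) (X' w)%:E)%E) ->
  P.-integrable setT (EFin \o (Y \* X)) ->
  P.-integrable setT (EFin \o (Y \* X')) ->
  \int[P]_w (Y w * X w) = \int[P]_w (Y w * X' w).
Proof.
move=> mY iX iX' XX' iYX iYX'.
pose D w := X w - X' w.
have iD : P.-integrable setT (EFin \o D).
  by apply: eq_integrable (integrableB measurableT iX iX') => // x _.
have iYD : P.-integrable setT (EFin \o (Y \* D)).
  apply: eq_integrable (integrableB measurableT iYX iYX') => // x _.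
  by rewrite /= /D mulrBr.
have D0 A : G A -> (\int[P]_(w in A) (D w)%:E = 0)%E.
  move=> GA; have mA := Gm GA.
  have iA (Z : Omega -> R) : P.-integrable setT (EFin \o Z) ->
    P.-integrable A (EFin \o Z) by exact: integrableS.
  rewrite (integralB_EFin mA (iA _ iX) (iA _ iX')) XX'// subee//.
  by apply: integrable_fin_num => //; exact: iA.
have mYT := measurable_wrt_fun mY.
have mp : measurable_wrt G Y^\+.
  by apply/measurable_wrtP; apply: measurable_funrpos; exact/measurable_wrtP.
have mn : measurable_wrt G Y^\-.
  by apply/measurable_wrtP; apply: measurable_funrneg; exact/measurable_wrtP.
have mD : measurable_fun setT D by exact/measurable_EFinP/(measurable_int _ iD).
have ip : P.-integrable setT (EFin \o (Y^\+ \* D)).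
  apply: le_integrable iYD => //.
    by apply/measurable_EFinP; apply: measurable_funM => //;
      exact: measurable_wrt_fun mp.
  move=> x _; rewrite /= lee_fin !normrM ler_wpM2r// ger0_norm ?funrpos_ge0//.
  by rewrite /funrpos ge_max ler_norm normr_ge0.
have iYn : P.-integrable setT (EFin \o (Y^\- \* D)).
  apply: le_integrable iYD => //.
    by apply/measurable_EFinP; apply: measurable_funM => //;
      exact: measurable_wrt_fun mn.
  move=> x _; rewrite /= lee_fin !normrM ler_wpM2r// ger0_norm ?funrneg_ge0//.
  by rewrite /funrneg ge_max -normrN ler_norm normr_ge0.
apply/eqP; rewrite -subr_eq0 -RintegralB//; apply/eqP.
transitivity (\int[P]_w ((Y^\+ \* D) w - (Y^\- \* D) w)).
  apply: eq_Rintegral => w _; rewrite /= -mulrBl -mulrBr; congr (_ * _).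
  by rewrite -[in LHS](funrposBneg Y).
rewrite RintegralB// /Rintegral !integral_mul_wrt_eq0_ge0 ?subrr//.
Qed.

End conditioning.

(** * Real-valued expectation and square-integrable vectors *)

Section expectation.
Context {R : realType} {disp : measure_display} {Omega : measurableType disp}.
Variable P : probability Omega R.
Implicit Types X Y : Omega -> R.

Definition integrableR X := P.-integrable setT (EFin \o X).
(** Values lie in [R] rather than in the extended reals; [expectationE] relates it to ['E_P] for
    integrable variables. *)
Definition expect X : R := \int[P]_w X w.

Lemma integrableR_measurable X : integrableR X -> measurable_fun setT X.
Proof. by move=> iX; exact/measurable_EFinP/(measurable_int _ iX). Qed.

Lemma integrableRD X Y : integrableR X -> integrableR Y ->
  integrableR (fun w => X w + Y w).
Proof. by move=> iX iY; apply: eq_integrable (integrableD measurableT iX iY). Qed.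

Lemma integrableRZ k X : integrableR X -> integrableR (fun w => k * X w).
Proof. by move=> iX; apply: eq_integrable (integrableZl measurableT k iX). Qed.

Lemma integrableRB X Y : integrableR X -> integrableR Y ->
  integrableR (fun w => X w - Y w).
Proof. by move=> iX iY; apply: eq_integrable (integrableB measurableT iX iY). Qed.

Lemma integrableR_cst k : integrableR (fun=> k).
Proof. exact: finite_measure_integrable_cst. Qed.

Lemma integrableR_le X Y : measurable_fun setT X ->
  (forall w, `|X w| <= Y w) -> integrableR Y -> integrableR X.
Proof.
move=> mX XY; apply: le_integrable => //; first exact/measurable_EFinP.
by move=> w _; rewrite /= lee_fin (le_trans (XY w))// ler_norm.
Qed.

Lemma integrableR_ge0_le X Y : measurable_fun setT X -> (forall w, 0 <= X w) ->
  (forall w, X w <= Y w) -> integrableR Y -> integrableR X.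
Proof. by move=> mX X0 XY; apply: integrableR_le => // w; rewrite ger0_norm. Qed.

Lemma expectD X Y : integrableR X -> integrableR Y ->
  expect (fun w => X w + Y w) = expect X + expect Y.
Proof. exact: RintegralD. Qed.

Lemma expectB X Y : integrableR X -> integrableR Y ->
  expect (fun w => X w - Y w) = expect X - expect Y.
Proof. exact: RintegralB. Qed.

Lemma expectZ k X : integrableR X -> expect (fun w => k * X w) = k * expect X.
Proof. by move=> iX; exact: RintegralZl. Qed.

Lemma expect_le X Y : integrableR X -> integrableR Y ->
  (forall w, X w <= Y w) -> expect X <= expect Y.
Proof. by move=> iX iY XY; apply: le_Rintegral => // w _. Qed.

Lemma expect_ge0 X : (forall w, 0 <= X w) -> 0 <= expect X.
Proof. by move=> X0; exact: Rintegral_ge0. Qed.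

Lemma expectationE X : integrableR X -> ('E_P[X] = (expect X)%:E)%E.
Proof. by move=> iX; rewrite unlock fineK// integrable_fin_num. Qed.

(** For a nonnegative variable, a finite bound on the extended expectation already gives
    integrability. This is how the moment assumptions of the theorem yield integrable gaps and
    oracle outputs. *)
Lemma integrableR_expectation_le X k : measurable_fun setT X ->
  (forall w, 0 <= X w) -> ('E_P[X] <= k%:E)%E ->
  integrableR X /\ expect X <= k.
Proof.
rewrite unlock => mX X0 Xk; have iX : integrableR X.
  apply/integrableP; split; first exact/measurable_EFinP.
  under eq_integral do rewrite /= ger0_norm//.
  exact: le_lt_trans Xk (ltry _).
split=> //; rewrite -lee_fin /expect /Rintegral fineK//.
exact: integrable_fin_num.
Qed.

Lemma integrableR_sum (I : eqType) (r : seq I) (F : I -> Omega -> R) :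
  (forall i, i \in r -> integrableR (F i)) ->
  integrableR (fun w => \sum_(i <- r) F i w) /\
  expect (fun w => \sum_(i <- r) F i w) = \sum_(i <- r) expect (F i).
Proof.
elim: r => [_|i r IH iF].
  under [X in integrableR X]eq_fun do rewrite big_nil.
  under [X in expect X]eq_fun do rewrite big_nil.
  rewrite big_nil; split; first exact: integrableR_cst.
  by rewrite /expect Rintegral_cst// mul0r.
under [X in integrableR X]eq_fun do rewrite big_cons.
under [X in expect X]eq_fun do rewrite big_cons.
have iFi : integrableR (F i) by apply: iF; rewrite mem_head.
have [|iS eS] := IH; first by move=> k kr; apply: iF; rewrite inE kr orbT.
by rewrite big_cons -eS expectD//; split=> //; exact: integrableRD.
Qed.

Section vectors.
Context {d : nat}.
Implicit Types U V : Omega -> 'rV[R]_d.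

Definition vmeasurable V := forall j, measurable_fun setT (fun w => V w 0 j).

Lemma measurable_dot U V : vmeasurable U -> vmeasurable V ->
  measurable_fun setT (fun w => dot (U w) (V w)).
Proof.
by move=> mU mV; apply: measurable_sum => j; apply: measurable_funM.
Qed.

Definition square_integrable V :=
  vmeasurable V /\ integrableR (fun w => dot (V w) (V w)).

Lemma integrableR_dot U V : square_integrable U -> square_integrable V ->
  integrableR (fun w => dot (U w) (V w)).
Proof.
move=> [mU iU] [mV iV]; apply: (integrableR_le _ _ (integrableRD iU iV)).
  exact: measurable_dot.
move=> w; have := dot_young (U w) (V w) ltr01.
have := dot_young (- U w) (V w) ltr01; have := dotvv_ge0 (U w).
have := dotvv_ge0 (V w); rewrite !dotNl dotNr invr1 !mul1r opprK ler_norml.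
by move=> ? ? ? ?; apply/andP; split; lra.
Qed.

Lemma integrableR_coord U V j : square_integrable U -> square_integrable V ->
  integrableR (fun w => U w 0 j * V w 0 j).
Proof.
move=> [mU iU] [mV iV]; apply: (integrableR_le _ _ (integrableRD iU iV)).
  exact: measurable_funM.
move=> w; have := sqr_coord_le_dotvv (U w) j; have := sqr_coord_le_dotvv (V w) j.
move: (U w 0 j) (V w 0 j) => a b; rewrite normrM -(real_normK (num_real a)).
rewrite -(real_normK (num_real b)); have := normr_ge0 a; have := normr_ge0 b.
by nra.
Qed.

(** The pull-out property is applied to each coordinate; square integrability makes every coordinate
    product integrable. *)
Lemma expect_dot_cond (G : set (set Omega)) U V W :
  sigma_algebra setT G -> G `<=` measurable -> vmeasurable_wrt G U ->
  is_vcond_expectation P G V W ->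
  square_integrable U -> square_integrable V -> square_integrable W ->
  expect (fun w => dot (U w) (V w)) = expect (fun w => dot (U w) (W w)).
Proof.
move=> sG Gm mU cVW sU sV sW.
rewrite (integrableR_sum (fun j _ => integrableR_coord j sU sV)).2.
rewrite (integrableR_sum (fun j _ => integrableR_coord j sU sW)).2.
apply: eq_bigr => j _; have [iV iW _ VW] := cVW j.
apply: (integral_mul_wrt_eq sG Gm (mU j) iV iW VW); exact: integrableR_coord.
Qed.

End vectors.

End expectation.

(** * Random vectors measurable with respect to a sub-sigma-algebra *)

Section vector_measurability.
Context {R : realType} {d : nat}.

Lemma vmeasurable_lincomb {disp : measure_display} {T : measurableType disp}
    (a b : R) (X Y : T -> 'rV[R]_d) :
  vmeasurable X -> vmeasurable Y ->
  vmeasurable (fun w => a *: X w + b *: Y w).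
Proof.
move=> mX mY j; under eq_fun do rewrite !mxE.
by apply: measurable_funD; apply: measurable_funM.
Qed.

Context {disp : measure_display} {Omega : measurableType disp}.
Variable G : set (set Omega).
Hypotheses (sG : sigma_algebra setT G) (Gm : G `<=` measurable).
Implicit Types X Y : Omega -> 'rV[R]_d.

Lemma vmeasurable_wrtP X :
  vmeasurable_wrt G X <-> vmeasurable (X : g_sigma_algebraType G -> _).
Proof. by split=> mX j; apply/measurable_wrtP. Qed.

Lemma vmeasurable_wrt_vmeasurable X : vmeasurable_wrt G X -> vmeasurable X.
Proof. by move=> mX j; exact: measurable_wrt_fun (mX j). Qed.

Lemma vmeasurable_wrt_lincomb (a b : R) X Y :
  vmeasurable_wrt G X -> vmeasurable_wrt G Y ->
  vmeasurable_wrt G (fun w => a *: X w + b *: Y w).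
Proof.
move=> /vmeasurable_wrtP mX /vmeasurable_wrtP mY.
by apply/vmeasurable_wrtP; exact: vmeasurable_lincomb.
Qed.

Lemma measurable_wrt_continuous (h : 'rV[R]_d -> R) X :
  continuous h -> vmeasurable_wrt G X -> measurable_wrt G (h \o X).
Proof.
move=> ch /vmeasurable_wrtP mX; apply/measurable_wrtP => //.
exact: (measurable_continuous_rV ch mX).
Qed.

End vector_measurability.

(** * Expected descent in one iteration *)

(** Here [z] and [z'] stand for the expected gaps at the auxiliary point before and after the step,
    [a] for [E |grad f(x)|^2], [b] for [E <grad f(z), grad f(x)>], [p] and [q] for the second
    moments of velocity and oracle output, and [s] for a common bound on [a], [p] and [q]. *)
Lemma descent_arith {R : realFieldType} (z z' a b p q s L c e : R) :
  0 < L -> 0 < c -> 0 < e ->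
  z' <= z - e * b + L / 2 * e ^+ 2 * q ->
  a - b <= L * (c * e) / 2 * (p + a) ->
  p <= s -> a <= s -> q <= s ->
  a <= (z - z') / e + (L * c + L / 2) * s * e.
Proof.
move=> hL c0 e0 H1 H2 ps sa sq.
have Lce0 : 0 <= L * (c * e) / 2.
  by rewrite divr_ge0// ltW// mulr_gt0// mulr_gt0.
have H3 : L * (c * e) / 2 * (p + a) <= L * (c * e) / 2 * (s + s).
  by rewrite ler_wpM2l// lerD.
have H4 : L / 2 * e ^+ 2 * q <= L / 2 * e ^+ 2 * s.
  by rewrite ler_wpM2l// mulr_ge0 ?sqr_ge0// divr_ge0// ltW.
rewrite -lerBlDr ler_pdivlMr//.
have H5 : e * (a - b) <= e * (L * (c * e) / 2 * (s + s)).
  by rewrite ler_wpM2l ?(ltW e0)//; lra.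
rewrite -subr_ge0.
have -> : z - z' - (a - (L * c + L / 2) * s * e) * e =
  (z - e * b + L / 2 * e ^+ 2 * s - z') +
  (e * (L * (c * e) / 2 * (s + s)) - e * (a - b)) by field.
by apply: addr_ge0; lra.
Qed.

Section one_step.
Context {R : realType} {d : nat} (f : 'rV[R]_d -> R) (L fstar : R).
Hypothesis hf_diff : forall x, differentiable f x.
Hypothesis hL : 0 < L.
Hypothesis hf_lip :
  forall x y, l2norm (grad f x - grad f y) <= L * l2norm (x - y).
Hypothesis hfstar : forall x, fstar <= f x.
Context {disp : measure_display} {Omega : measurableType disp}.
Variable P : probability Omega R.
Implicit Types X V : Omega -> 'rV[R]_d.

Local Notation I := (integrableR P).
Local Notation E := (expect P).
Local Notation gap X := (fun w => f (X w) - fstar).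

Lemma continuous_objective : continuous f.
Proof. by move=> x; exact/differentiable_continuous. Qed.

Lemma measurable_gap X : vmeasurable X -> measurable_fun setT (gap X).
Proof.
move=> mX; apply: measurable_funB => //.
exact: (measurable_continuous_rV continuous_objective mX).
Qed.

Lemma gap_ge0 x : 0 <= f x - fstar.
Proof. by rewrite subr_ge0. Qed.

Lemma vmeasurable_grad X : vmeasurable X -> vmeasurable (fun w => grad f (X w)).
Proof.
move=> mX j; have cj := grad_coord_continuous hL hf_lip (j := j).
exact: (measurable_continuous_rV cj mX).
Qed.

(** By [sqr_grad_le] the squared gradient is dominated by [2 L] times the integrable gap. *)
Lemma square_integrable_grad X : vmeasurable X -> I (gap X) ->
  square_integrable P (fun w => grad f (X w)).
Proof.
move=> mX iX; split; first exact: vmeasurable_grad.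
apply: (integrableR_ge0_le _ _ _ (integrableRZ (2 * L) iX)).
- by apply: measurable_dot; exact: vmeasurable_grad.
- by move=> w; exact: dotvv_ge0.
- by move=> w; exact: (sqr_grad_le hf_diff hL hf_lip hfstar).
Qed.

Lemma momentum_gap X V (c e : R) : 0 <= c ->
  vmeasurable X -> I (gap X) -> square_integrable P V ->
  I (gap (fun w => X w - (c * e) *: V w)) /\
  E (gap (fun w => X w - (c * e) *: V w)) <=
    (1 + c) * E (gap X) +
    (c + c ^+ 2) * (L * e ^+ 2 / 2) * E (fun w => dot (V w) (V w)).
Proof.
move=> c0 mX iX [mV iV].
have le w := momentum_point_le hf_diff hL hf_lip hfstar (X w) (V w) e c0.
have mZ : vmeasurable (fun w => X w - (c * e) *: V w).
  under eq_fun do rewrite -[X _]scale1r -scaleNr.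
  exact: vmeasurable_lincomb.
have iR : I (fun w => (1 + c) * (f (X w) - fstar) +
    (c + c ^+ 2) * (L * e ^+ 2 / 2) * dot (V w) (V w)).
  by apply: integrableRD; exact: integrableRZ.
have iZ : I (gap (fun w => X w - (c * e) *: V w)).
  apply: (integrableR_ge0_le _ _ le iR); first exact: measurable_gap.
  by move=> w; exact: gap_ge0.
split=> //; apply: le_trans (expect_le iZ iR le) _.
by rewrite (expectD (integrableRZ _ iX) (integrableRZ _ iV)) !expectZ.
Qed.

Lemma stepsize_change_gap X V (c e1 e2 : R) : 0 < e2 -> e2 <= e1 -> e1 <= 1 / L ->
  0 <= c -> vmeasurable X -> I (gap X) -> square_integrable P V ->
  E (gap (fun w => X w - (c * e2) *: V w)) / e2 <=
  E (gap (fun w => X w - (c * e1) *: V w)) / e1 +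
  (e2^-1 - e1^-1) *
    (E (gap X) + c ^+ 2 / (2 * L) * E (fun w => dot (V w) (V w))).
Proof.
move=> e20 e21 e1L c0 mX iX sV.
have [i1 _] := momentum_gap e1 c0 mX iX sV.
have [i2 _] := momentum_gap e2 c0 mX iX sV.
have iK : I (fun w => f (X w) - fstar + c ^+ 2 / (2 * L) * dot (V w) (V w)).
  by apply: integrableRD => //; apply: integrableRZ; exact: sV.2.
have iR : I (fun w => e1^-1 * (f (X w - (c * e1) *: V w) - fstar) +
    (e2^-1 - e1^-1) * (f (X w) - fstar + c ^+ 2 / (2 * L) * dot (V w) (V w))).
  by apply: integrableRD; exact: integrableRZ.
rewrite -(expectZ _ sV.2) -(expectD iX (integrableRZ _ sV.2)) -(expectZ _ iK).
rewrite ![E _ / _]mulrC -(expectZ _ i1) -(expectZ _ i2).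
rewrite -(expectD (integrableRZ _ i1) (integrableRZ _ iK)).
apply: expect_le => //; first exact: integrableRZ.
move=> w; rewrite ![_^-1 * (f _ - _)]mulrC.
exact: (stepsize_change_le _ hf_diff hL hf_lip).
Qed.

(* Jensen's inequality for the conditional expectation, obtained from
   [E |grad - g|^2 >= 0]. *)
Lemma expect_sqr_grad_le (G : set (set Omega)) X g (s : R) :
  sigma_algebra setT G -> G `<=` measurable ->
  vmeasurable_wrt G X -> I (gap X) -> square_integrable P g ->
  is_vcond_expectation P G g (fun w => grad f (X w)) ->
  E (fun w => dot (g w) (g w)) <= s ->
  E (fun w => dot (grad f (X w)) (grad f (X w))) <= s.
Proof.
move=> sG Gm mX iX sg cg gs.
have sX := square_integrable_grad (vmeasurable_wrt_vmeasurable Gm mX) iX.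
have mgX : vmeasurable_wrt G (fun w => grad f (X w)).
  move=> j; have cj := grad_coord_continuous hL hf_lip (j := j).
  exact: (measurable_wrt_continuous sG cj mX).
have Ec := expect_dot_cond sG Gm mgX cg sX sg sX.
have iXg := integrableR_dot sX sg.
have : E (fun w => 2 * dot (grad f (X w)) (g w)) <=
    E (fun w => dot (grad f (X w)) (grad f (X w)) + dot (g w) (g w)).
  apply: expect_le; first exact: integrableRZ.
    by apply: integrableRD; [exact: sX.2|exact: sg.2].
  by move=> w; have := dot_young (grad f (X w)) (g w) ltr01; rewrite invr1 !mul1r.
rewrite (expectZ _ iXg) (expectD sX.2 sg.2).
by rewrite Ec; lra.
Qed.

(** The auxiliary point is [G]-measurable, so unbiasedness turns [E <grad f(Z), g>] into
    [E <grad f(Z), grad f(X)>]. By [cross_grad_le] the latter differs from [E |grad f(X)|^2] only by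
    a term proportional to [e]. *)
Lemma one_step_descent (G : set (set Omega)) X V g (c e s : R) :
  sigma_algebra setT G -> G `<=` measurable ->
  vmeasurable_wrt G X -> vmeasurable_wrt G V ->
  I (gap X) -> square_integrable P V -> square_integrable P g ->
  is_vcond_expectation P G g (fun w => grad f (X w)) ->
  E (fun w => dot (V w) (V w)) <= s -> E (fun w => dot (g w) (g w)) <= s ->
  0 < c -> 0 < e ->
  E (fun w => dot (grad f (X w)) (grad f (X w))) <=
  (E (gap (fun w => X w - (c * e) *: V w)) -
   E (gap (fun w => X w - (c * e) *: V w - e *: g w))) / e +
  (L * c + L / 2) * s * e.
Proof.
move=> sG Gm mX mV iX sV sg cg Vs gs c0 e0.
have Xs := expect_sqr_grad_le sG Gm mX iX sg cg gs.
have mXT := vmeasurable_wrt_vmeasurable Gm mX.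
have sX := square_integrable_grad mXT iX.
pose Z w := X w - (c * e) *: V w.
have mZ : vmeasurable_wrt G Z.
  rewrite /Z; under [X in vmeasurable_wrt G X]eq_fun do
    rewrite -[X _]scale1r -scaleNr.
  exact: vmeasurable_wrt_lincomb.
have mZT := vmeasurable_wrt_vmeasurable Gm mZ.
have iZ : I (gap Z) := (momentum_gap e (ltW c0) mXT iX sV).1.
have sZ := square_integrable_grad mZT iZ.
have mgZ : vmeasurable_wrt G (fun w => grad f (Z w)).
  move=> j; have cj := grad_coord_continuous hL hf_lip (j := j).
  exact: (measurable_wrt_continuous sG cj mZ).
(* The stochastic gradient is evaluated at [X], while the step is taken from [Z]; only the
   measurability of [Z] is needed to replace [g] by [grad f (X w)] here. *)
have Ec := expect_dot_cond sG Gm mgZ cg sZ sg sX.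
have iZg := integrableR_dot sZ sg; have iZX := integrableR_dot sZ sX.
have h1 w : f (Z w - e *: g w) - fstar <=
    (f (Z w) - fstar - e * dot (grad f (Z w)) (g w)) +
    L / 2 * e ^+ 2 * dot (g w) (g w).
  exact: (gradient_step_le fstar hf_diff hL hf_lip).
have iR : I (fun w => (f (Z w) - fstar - e * dot (grad f (Z w)) (g w)) +
    L / 2 * e ^+ 2 * dot (g w) (g w)).
  apply: integrableRD; last by apply: integrableRZ; exact: sg.2.
  by apply: integrableRB => //; exact: integrableRZ.
have iZ' : I (gap (fun w => Z w - e *: g w)).
  apply: (integrableR_ge0_le _ _ h1 iR); last by move=> w; exact: gap_ge0.
  apply: measurable_gap; under [X in vmeasurable X]eq_fun do
    rewrite -[Z _]scale1r -scaleNr.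
  by apply: vmeasurable_lincomb => //; exact: sg.1.
have H1 := expect_le iZ' iR h1.
rewrite (expectD (integrableRB iZ (integrableRZ e iZg))
  (integrableRZ _ sg.2)) in H1.
rewrite (expectB iZ (integrableRZ e iZg)) (expectZ _ iZg) (expectZ _ sg.2) Ec in H1.
have iq : I (fun w => L * (c * e) / 2 *
    (dot (V w) (V w) + dot (grad f (X w)) (grad f (X w)))).
  by apply: integrableRZ; apply: integrableRD; [exact: sV.2|exact: sX.2].
have H2 : E (fun w => dot (grad f (X w)) (grad f (X w)) -
      dot (grad f (Z w)) (grad f (X w))) <=
    E (fun w => L * (c * e) / 2 *
      (dot (V w) (V w) + dot (grad f (X w)) (grad f (X w)))).
  apply: expect_le => //; first by apply: integrableRB => //; exact: sX.2.
  by move=> w; exact: (cross_grad_le hL hf_lip (X w) (V w) c0 e0).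
rewrite (expectB sX.2 iZX) (expectZ _ (integrableRD sV.2 sX.2)) in H2.
rewrite (expectD sV.2 sX.2) in H2; exact: (descent_arith hL c0 e0) H1 H2 Vs Xs gs.
Qed.

End one_step.

(** * Expectation at the random output index *)

Section random_output.
Context {R : realType} {disp : measure_display} {Omega : measurableType disp}.
Variables (P : probability Omega R) (delta : nat -> R) (N : nat) (S : nat -> nat).
Variables (G : set (set Omega)) (tstar istar : {RV P >-> nat}).
Hypotheses (sG : sigma_algebra setT G) (Gm : G `<=` measurable).
Hypothesis hout : output_index delta N S G tstar istar.

Let event t i : set Omega := tstar @^-1` [set t] `&` istar @^-1` [set i].

Let measurable_event t i : measurable (event t i).
Proof. by apply: measurableI; exact: measurable_funPTI. Qed.

Let prob_event t i : (1 <= t <= N)%N -> (1 <= i <= S t)%N ->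
  P (event t i) = (stage_prob N delta t / (S t)%:R)%:E.
Proof. by move=> tN iS; rewrite (out_iter hout)// (out_stage hout)// EFinM. Qed.

(** By independence, the indicator of the event and the constant equal to its probability have the
    same integral over every set of [G]; [integral_mul_wrt_eq] then factors the expectation. *)
Lemma expect_mul_event t i (Y : Omega -> R) :
  (1 <= t <= N)%N -> (1 <= i <= S t)%N ->
  measurable_wrt G Y -> integrableR P Y ->
  integrableR P (fun w => Y w * \1_(event t i) w) /\
  expect P (fun w => Y w * \1_(event t i) w) =
    stage_prob N delta t / (S t)%:R * expect P Y.
Proof.
move=> tN iS mY iY; set p := stage_prob _ _ _ / _.
have iYc : integrableR P (fun w => Y w * p).
  by under eq_fun do rewrite mulrC; exact: integrableRZ.
have iYe : integrableR P (fun w => Y w * \1_(event t i) w).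
  apply: (integrableR_le _ _ (integrable_norm iY)).
    apply: measurable_funM; first exact: integrableR_measurable iY.
    exact: measurable_indic.
  move=> w; rewrite /= normrM -[leRHS]mulr1 ler_wpM2l//.
  by rewrite indicE normr_nat lern1 leq_b1.
split=> //; rewrite -expectZ//; transitivity (expect P (fun w => Y w * p)).
  apply: (integral_mul_wrt_eq sG Gm mY (X := \1_(event t i)) (X' := fun=> p)) => //.
  - exact: integrable_indic.
  - exact: integrableR_cst.
  - move=> A GA; rewrite integral_indic//; last exact: Gm.
    transitivity (P (event t i) * P A)%E; first exact: (out_indep hout t i GA).
    by rewrite prob_event// integral_cst//; exact: Gm.
by congr expect; apply/funext => w; rewrite mulrC.
Qed.

(** The range conditions make the events for [(t, i)] a partition, so exactly one indicator is
    nonzero at [w]. *)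
Lemma output_decomposition (h : nat -> nat -> Omega -> R) w :
  h (tstar w) (istar w) w =
  \sum_(1 <= t < N.+1) \sum_(1 <= i < (S t).+1) h t i w * \1_(event t i) w.
Proof.
have tr := out_stage_range hout w; have ir := out_iter_range hout w.
rewrite (bigD1_seq (tstar w)) ?iota_uniq ?mem_index_iota//=.
rewrite [X in _ = X + _](bigD1_seq (istar w)) ?iota_uniq ?mem_index_iota//=.
rewrite indicE mem_set// mulr1 big1 ?addr0 => [|i ine]; last first.
  by rewrite indicE memNset ?mulr0// => -[/= _ /esym]; exact/eqP.
rewrite big1 ?addr0// => t tne; rewrite big1// => i _.
by rewrite indicE memNset ?mulr0// => -[/= /esym + _]; exact/eqP.
Qed.

Lemma output_expectation (h : nat -> nat -> Omega -> R) :
  (forall t i, (1 <= t <= N)%N -> (1 <= i <= S t)%N ->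
    measurable_wrt G (h t i) /\ integrableR P (h t i)) ->
  ('E_P[fun w => (h (tstar w) (istar w) w)%R] =
  (\sum_(1 <= t < N.+1) \sum_(1 <= i < (S t).+1)
     stage_prob N delta t / (S t)%:R * expect P (h t i))%:E)%E.
Proof.
move=> hP; under [X in expectation _ X]eq_fun do rewrite output_decomposition.
have inner t : t \in index_iota 1 N.+1 ->
  integrableR P (fun w => \sum_(1 <= i < (S t).+1) h t i w * \1_(event t i) w) /\
  expect P (fun w => \sum_(1 <= i < (S t).+1) h t i w * \1_(event t i) w) =
  \sum_(1 <= i < (S t).+1) stage_prob N delta t / (S t)%:R * expect P (h t i).
  rewrite mem_index_iota => tN.
  have [|iI eI] := @integrableR_sum _ _ _ P _ (index_iota 1 (S t).+1)
    (fun i w => h t i w * \1_(event t i) w).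
    move=> i; rewrite mem_index_iota => iS; have [mh ih] := hP t i tN iS.
    by have [] := expect_mul_event tN iS mh ih.
  split=> //; rewrite eI; apply: eq_big_nat => i iS.
  have [mh ih] := hP t i tN iS; by have [] := expect_mul_event tN iS mh ih.
have [|iI eI] := @integrableR_sum _ _ _ P _ (index_iota 1 N.+1)
    (fun t w => \sum_(1 <= i < (S t).+1) h t i w * \1_(event t i) w).
  by move=> t /inner[].
rewrite expectationE// eI; congr (_ %:E); apply: eq_big_nat => t tN.
by apply: (inner t _).2; rewrite mem_index_iota.
Qed.

End random_output.

(* [p i] and [q i] stand for the expected gaps at the auxiliary point before and
   after iteration [i]. *)
Lemma stage_telescope (R : realFieldType) (a p q e : nat -> R) (K B : R) (s : nat) :
  (1 <= s)%N ->
  (forall i, (1 <= i <= s)%N -> a i <= (p i - q i) / e i + B * e i) ->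
  (forall i, (1 <= i < s)%N ->
    p i.+1 / e i.+1 <= q i / e i + ((e i.+1)^-1 - (e i)^-1) * K) ->
  p 1%N <= K -> 0 <= q s -> (forall i, (1 <= i <= s)%N -> 0 < e i) ->
  \sum_(1 <= i < s.+1) a i <= K / e s + B * \sum_(1 <= i < s.+1) e i.
Proof.
move=> s1 hstep hswitch p1 qs e0.
(* The induction keeps the term [- q k / e k], which absorbs the [q k / e k] produced by the next
   change of step-size; the coefficients of [K] then collapse to [1 / e k]. *)
suff H k : (1 <= k <= s)%N -> \sum_(1 <= i < k.+1) a i <=
    K / e k - q k / e k + B * \sum_(1 <= i < k.+1) e i.
  have := H s; rewrite s1 leqnn => /(_ isT) /le_trans; apply.
  by rewrite lerD2r gerBl divr_ge0// ltW// e0// s1 leqnn.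
elim: k => // -[_ hs|k IH hk].
  rewrite !big_nat1; apply: le_trans (hstep _ hs) _; rewrite lerD2r mulrBl.
  by rewrite lerD2r ler_wpM2r// invr_ge0 ltW// e0.
have hk' : (1 <= k.+1 <= s)%N by case/andP: hk => _ /ltnW ->.
rewrite big_nat_recr//= [in leRHS]big_nat_recr//=.
apply: le_trans (lerD (IH hk') (hstep _ hk)) _.
have : (1 <= k.+1 < s)%N by case/andP: hk => _ ->.
move=> /hswitch; rewrite !mulrBl mulrDr.
rewrite [(e k.+2)^-1 * K]mulrC [(e k.+1)^-1 * K]mulrC.
by lra.
Qed.

(** * Moment bounds along the run and the bound for one stage *)

Section run.
Context {R : realType} {d : nat} {disp : measure_display}.
Context {Omega : measurableType disp} (P : probability Omega R).
Variables (f : 'rV[R]_d -> R) (L fstar : R).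
Hypothesis hf_diff : forall x, differentiable f x.
Hypothesis hL : 0 < L.
Hypothesis hf_lip :
  forall x y, l2norm (grad f x - grad f y) <= L * l2norm (x - y).
Hypothesis hfstar : forall x, fstar <= f x.
Variables (beta m M G Delta0 : R) (delta : nat -> R).
Variables (T N : nat) (S : nat -> nat) (n : nat -> nat -> R) (x11 : 'rV[R]_d).
Variables (F : nat -> nat -> set (set Omega)).
Variables (x v g : nat -> nat -> Omega -> 'rV[R]_d).
Hypothesis hrun : sgdm_run P f beta m M delta T N S n x11 F x v g.
Hypothesis hG : forall t i, (1 <= t <= N)%N -> (1 <= i <= S t)%N ->
  ('E_P[fun w => (l2norm (g t i w) ^+ 2)%R] <= (G ^+ 2)%:E)%E.
Hypothesis hDelta0 : forall t i, (1 <= t <= N)%N -> (1 <= i <= S t)%N ->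
  ('E_P[fun w => (f (x t i w) - fstar)%R] <= Delta0%:E)%E.
Hypothesis heta_decr : forall t i, (1 <= t <= N)%N -> (2 <= i <= S t)%N ->
  stepsize n delta t i <= stepsize n delta t i.-1.
Hypothesis heta_le : forall t i, (1 <= t <= N)%N -> (1 <= i <= S t)%N ->
  stepsize n delta t i <= 1 / L.

Local Notation E := (expect P).
Local Notation eta := (stepsize n delta).
Local Notation c := (beta / (1 - beta)).

Let beta01 := run_beta hrun.
Let filtr := run_filtr hrun.

Let beta_gt0 : 0 < beta. Proof. by case/andP: beta01. Qed.
Let beta_lt1 : 0 < 1 - beta. Proof. by rewrite subr_gt0; case/andP: beta01. Qed.
Let c_gt0 : 0 < c. Proof. by rewrite divr_gt0. Qed.

Let iter_le t i : (1 <= i <= S t)%N -> (1 <= i <= (S t).+1)%N.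
Proof. by case/andP=> -> /leqW. Qed.

Lemma filtration_sigma t i : (1 <= t <= N)%N -> (1 <= i <= (S t).+1)%N ->
  sigma_algebra setT (F t i).
Proof. by move=> tN iS; have [] := rf_sigma filtr tN iS. Qed.

Lemma filtration_measurable t i : (1 <= t <= N)%N -> (1 <= i <= (S t).+1)%N ->
  F t i `<=` measurable.
Proof. by move=> tN iS; have [] := rf_sigma filtr tN iS. Qed.

Lemma filtration_stage_end t i : (1 <= t <= N)%N -> (1 <= i <= (S t).+1)%N ->
  F t i `<=` F t (S t).+1.
Proof.
move=> tN; move: {2}((S t).+1 - i)%N (erefl ((S t).+1 - i)%N) => k.
elim: k i => [|k IH] i ki /andP[i1 iS].
  suff -> : i = (S t).+1 by [].
  by apply/eqP; rewrite eqn_leq iS -subn_eq0 ki.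
have iS' : (i <= S t)%N by rewrite -ltnS -subn_gt0 ki.
apply: subset_trans (rf_mono filtr tN _) (IH _ _ _); rewrite ?i1//.
by rewrite subnS ki.
Qed.

(** The output index is independent of the sigma-algebra of the whole run, so every iterate has to
    be measurable with respect to that one. *)
Lemma filtration_end t i : (1 <= t <= N)%N -> (1 <= i <= (S t).+1)%N ->
  F t i `<=` F N (S N).+1.
Proof.
move: {2}(N - t)%N (erefl (N - t)%N) => k.
elim: k t i => [|k IH] t i kt tN iS.
  have -> : N = t by apply/eqP; rewrite eqn_leq -subn_eq0 kt; case/andP: tN.
  exact: filtration_stage_end.
have tN' : (t < N)%N by rewrite -subn_gt0 kt.
apply: subset_trans (filtration_stage_end tN iS) _.
have t1 : (1 <= t)%N by case/andP: tN.
apply: subset_trans (rf_next filtr _) (IH _ _ _ _ _); rewrite ?t1 ?tN'//.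
by rewrite subnS kt.
Qed.

Lemma iterate_measurable t i : (1 <= t <= N)%N -> (1 <= i <= S t)%N ->
  vmeasurable (x t i).
Proof.
move=> tN iS; apply: vmeasurable_wrt_vmeasurable (rf_iterate filtr tN iS).
exact: filtration_measurable (iter_le iS).
Qed.

Lemma oracle_square_integrable t i : (1 <= t <= N)%N -> (1 <= i <= S t)%N ->
  square_integrable P (g t i) /\ E (fun w => dot (g t i w) (g t i w)) <= G ^+ 2.
Proof.
move=> tN iS.
have mg : vmeasurable (g t i).
  apply: vmeasurable_wrt_vmeasurable (rf_oracle filtr tN iS).
  by apply: filtration_measurable => //; case/andP: iS.
have [|||ig gG] := @integrableR_expectation_le _ _ _ P
  (fun w => dot (g t i w) (g t i w)) (G ^+ 2).
- exact: measurable_dot.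
- by move=> w; exact: dotvv_ge0.
- by under eq_fun do rewrite -sqr_l2norm; exact: hG.
by [].
Qed.

Lemma iterate_gap t i : (1 <= t <= N)%N -> (1 <= i <= S t)%N ->
  integrableR P (fun w => f (x t i w) - fstar) /\
  E (fun w => f (x t i w) - fstar) <= Delta0.
Proof.
move=> tN iS; apply: integrableR_expectation_le; last exact: hDelta0.
  by apply: measurable_gap => //; exact: iterate_measurable.
by move=> w; rewrite subr_ge0.
Qed.

(** The invariant carried through the iterations and across stage boundaries. *)
Definition velocity_bound t i := [/\ vmeasurable_wrt (F t i) (v t i),
  square_integrable P (v t i) & E (fun w => dot (v t i w) (v t i w)) <= G ^+ 2].

(** The new velocity is a convex combination of the old one and the oracle output, so convexity of
    the squared norm preserves the bound [G ^+ 2]. *)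
Let velocity_step t i : (1 <= t <= N)%N -> (1 <= i <= S t)%N ->
  velocity_bound t i -> velocity_bound t i.+1.
Proof.
move=> tN iS [mv sv vG]; have [sg gG] := oracle_square_integrable tN iS.
have iS1 : (1 <= i.+1 <= (S t).+1)%N by case/andP: iS.
have vE : v t i.+1 = (fun w => beta *: v t i w + (1 - beta) *: g t i w).
  by apply/funext => w; exact: (run_v hrun w tN iS).
have mv' : vmeasurable_wrt (F t i.+1) (v t i.+1).
  rewrite vE; apply: vmeasurable_wrt_lincomb.
  - exact: filtration_sigma.
  - by move=> j; apply: subset_trans (mv j) (rf_mono filtr tN iS).
  - exact: (rf_oracle filtr tN iS).
have mvT := vmeasurable_wrt_vmeasurable (filtration_measurable tN iS1) mv'.
have le w : dot (v t i.+1 w) (v t i.+1 w) <=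
    beta * dot (v t i w) (v t i w) + (1 - beta) * dot (g t i w) (g t i w).
  rewrite vE !(dotDl, dotDr, dotZl, dotZr) (dotC (g t i w) (v t i w)).
  have := dot_young (v t i w) (g t i w) ltr01; rewrite invr1 !mul1r.
  have : 0 <= beta * (1 - beta) by rewrite mulr_ge0// ltW.
  move: (dot _ _) (dot _ _) (dot _ _) => a b e bb ab; nra.
have iR : integrableR P (fun w => beta * dot (v t i w) (v t i w) +
    (1 - beta) * dot (g t i w) (g t i w)).
  by apply: integrableRD; apply: integrableRZ; [exact: sv.2|exact: sg.2].
have iv' : integrableR P (fun w => dot (v t i.+1 w) (v t i.+1 w)).
  apply: (integrableR_ge0_le _ _ le iR); first exact: measurable_dot.
  by move=> w; exact: dotvv_ge0.
split=> //; apply: le_trans (expect_le iv' iR le) _.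
rewrite (expectD (integrableRZ _ sv.2) (integrableRZ _ sg.2)).
rewrite (expectZ _ sv.2) (expectZ _ sg.2).
have -> : G ^+ 2 = beta * G ^+ 2 + (1 - beta) * G ^+ 2 by ring.
by rewrite lerD// ler_wpM2l// ltW.
Qed.

(** Induction over stages, with an inner induction over iterations, starting from zero velocity. The
    range of [i] includes [(S t).+1] because that velocity is handed to the next stage. *)
Lemma velocity_bounded t i : (1 <= t <= N)%N -> (1 <= i <= (S t).+1)%N ->
  velocity_bound t i.
Proof.
have inner u : (1 <= u <= N)%N -> velocity_bound u 1%N ->
    forall k, (1 <= k <= (S u).+1)%N -> velocity_bound u k.
  move=> uN b1; elim=> // -[//|k] IH /andP[_ kS].
  by apply: velocity_step => //; apply: IH; exact: ltnW.
elim: t i => // -[_|t IH] i tN iS; apply: inner => //.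
  have v0 : v 1 1 = fun=> 0 by apply/funext => w; exact: run_v11 hrun w.
  have E0 : (fun w => dot (v 1 1 w) (v 1 1 w)) = fun=> 0.
    apply/funext => w; rewrite v0 /dot big1// => j _.
    by rewrite mxE mul0r.
  have mv : vmeasurable_wrt (F 1 1) (v 1%N 1%N).
    move=> j; apply/measurable_wrtP; first exact: filtration_sigma.
    by rewrite v0; under eq_fun do rewrite mxE; exact: measurable_cst.
  split=> //.
    split; last by rewrite E0; exact: integrableR_cst.
    by apply: vmeasurable_wrt_vmeasurable mv; exact: filtration_measurable.
  by rewrite E0 /expect Rintegral_cst// mul0r sqr_ge0.
have tN' : (1 <= t.+1 <= N)%N by case/andP: tN => _ /ltnW ->.
have tN2 : (1 <= t.+1 < N)%N by case/andP: tN => _ ->.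
have [mv sv vG] : velocity_bound t.+1 (S t.+1).+1.
  by apply: IH => //; rewrite leqnn.
have vE : v t.+2 1%N = v t.+1 (S t.+1).+1.
  by apply/funext => w; exact: (run_v_next hrun w tN2).
rewrite /velocity_bound vE; split => // j.
exact: subset_trans (mv j) (rf_next filtr tN2).
Qed.

Lemma stepsize_bounds t i : (1 <= t <= N)%N -> (1 <= i <= S t)%N ->
  0 < m * delta t /\ m * delta t <= eta t i <= M * delta t.
Proof.
move=> tN iS; have d0 := bf_gt0 (run_delta hrun) tN.
have /andP[m0 _] := run_mM hrun; split; first by rewrite mulr_gt0.
have /andP[mn nM] := run_band hrun tN iS.
by rewrite /stepsize !ler_wpM2r// ltW.
Qed.

Lemma stepsize_gt0 t i : (1 <= t <= N)%N -> (1 <= i <= S t)%N -> 0 < eta t i.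
Proof.
by move=> tN iS; have [m0 /andP[/(lt_le_trans m0)]] := stepsize_bounds tN iS.
Qed.

Lemma gap_bound_ge0 t i : (1 <= t <= N)%N -> (1 <= i <= S t)%N -> 0 <= Delta0.
Proof.
move=> tN iS; apply: le_trans (iterate_gap tN iS).2; apply: expect_ge0 => w.
by rewrite subr_ge0.
Qed.

(* The constant [Delta_z] of the statement. *)
Definition aux_gap_bound := Delta0 / (1 - beta) +
  beta * G ^+ 2 / (2 * (1 - beta) ^+ 2 * L).

Lemma auxiliary_gap_le t i : (1 <= t <= N)%N -> (1 <= i <= S t)%N ->
  E (fun w => f (x t i w - (c * eta t i) *: v t i w) - fstar) <= aux_gap_bound.
Proof.
move=> tN iS; have [ix xD] := iterate_gap tN iS.
have [_ sv vG] := velocity_bounded tN (iter_le iS).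
have mx := iterate_measurable tN iS.
have [_ h] := momentum_gap hf_diff hL hf_lip hfstar (eta t i) (ltW c_gt0) mx ix sv.
apply: le_trans h _.
have e0 := stepsize_gt0 tN iS; have eL := heta_le tN iS.
(* Uses [1 + c = 1 / (1 - beta)] and [c + c^2 = beta / (1 - beta)^2]; the factor [1 / (2 L)] comes
   from [L eta^2 / 2] with [eta <= 1 / L]. *)
have -> : aux_gap_bound = (1 + c) * Delta0 + (c + c ^+ 2) * ((2 * L)^-1 * G ^+ 2).
  by rewrite /aux_gap_bound; field; rewrite !gt_eqF.
have c1 : 0 <= 1 + c by rewrite addr_ge0// ltW.
have c2 : 0 <= c + c ^+ 2 by rewrite addr_ge0 ?sqr_ge0// ltW.
rewrite lerD ?ler_wpM2l// -mulrA ler_wpM2l// ler_pM//.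
- by rewrite divr_ge0// mulr_ge0 ?sqr_ge0// ltW.
- by apply: expect_ge0 => w; exact: dotvv_ge0.
- have Le1 : L * eta t i <= 1 by rewrite mulrC -ler_pdivlMr.
  rewrite invfM mulrC ler_pM2l ?invr_gt0// -(ler_pM2l hL) mulfV ?gt_eqF//.
  by rewrite mulrA -expr2 -exprMn expr_le1// mulr_ge0// ltW.
Qed.

(** The left side is what [stepsize_change_gap] charges per unit increase of [1 / eta]. Bounding it
    by the constant that also bounds the initial gap lets a stage telescope to a single quotient. *)
Lemma switch_constant_le t i : (1 <= t <= N)%N -> (1 <= i <= S t)%N ->
  E (fun w => f (x t i w) - fstar) +
  c ^+ 2 / (2 * L) * E (fun w => dot (v t i w) (v t i w)) <= aux_gap_bound.
Proof.
move=> tN iS; have [_ xD] := iterate_gap tN iS.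
have [_ _ vG] := velocity_bounded tN (iter_le iS).
have D0 := gap_bound_ge0 tN iS.
have -> : aux_gap_bound = (Delta0 + c ^+ 2 / (2 * L) * G ^+ 2) +
    (c * Delta0 + c * (G ^+ 2 / (2 * L))).
  by rewrite /aux_gap_bound; field; rewrite !gt_eqF.
rewrite -[leLHS]addr0 lerD//; last first.
  by rewrite addr_ge0// mulr_ge0 ?(ltW c_gt0)// divr_ge0 ?sqr_ge0// mulr_ge0// ltW.
rewrite lerD// ler_wpM2l// divr_ge0 ?sqr_ge0//; first by rewrite mulr_ge0// ltW.
Qed.

Lemma stage_bound t : (1 <= t <= N)%N -> (1 <= S t)%N ->
  \sum_(1 <= i < (S t).+1)
    E (fun w => dot (grad f (x t i w)) (grad f (x t i w))) <=
  aux_gap_bound / eta t (S t) +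
  (L * c + L / 2) * G ^+ 2 * \sum_(1 <= i < (S t).+1) eta t i.
Proof.
move=> tN S1.
apply: (@stage_telescope _ _
  (fun i => E (fun w => f (x t i w - (c * eta t i) *: v t i w) - fstar))
  (fun i => E (fun w =>
    f (x t i w - (c * eta t i) *: v t i w - eta t i *: g t i w) - fstar))) => //.
- move=> i iS; have [mv sv vG] := velocity_bounded tN (iter_le iS).
  have [sg gG] := oracle_square_integrable tN iS.
  apply: (one_step_descent hf_diff hL hf_lip hfstar
    (filtration_sigma tN (iter_le iS))
    (filtration_measurable tN (iter_le iS))) => //.
  + exact: (rf_iterate filtr tN iS).
  + exact: (iterate_gap tN iS).1.
  + exact: (run_unbiased hrun tN iS).
  + exact: stepsize_gt0.
- move=> i /andP[i1 iS].
  have iS0 : (1 <= i <= S t)%N by rewrite i1 ltnW.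
  have iS1 : (1 <= i.+1 <= S t)%N by [].
  have [_ sv _] := velocity_bounded tN (iter_le iS1).
  (* As [1 + c = 1 / (1 - beta)], the momentum update acts on the auxiliary point as a plain step
     along [g t i], with [eta t i] still in the momentum term. *)
  have zE w : x t i w - (c * eta t i) *: v t i w - eta t i *: g t i w =
      x t i.+1 w - (c * eta t i) *: v t i.+1 w.
    rewrite (run_x hrun w tN iS0) (run_v hrun w tN iS0).
    apply/rowP => j; rewrite !mxE.
    by field; rewrite gt_eqF.
  under [X in _ <= E X / _ + _]eq_fun do rewrite zE.
  have e21 : eta t i.+1 <= eta t i.
    by apply: (heta_decr (i := i.+1)); rewrite // ltnS i1.
  apply: le_trans (stepsize_change_gap hf_diff hL hf_lip hfstar
    (stepsize_gt0 tN iS1) e21 (heta_le tN iS0) (ltW c_gt0)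
    (iterate_measurable tN iS1) (iterate_gap tN iS1).1 sv) _.
  rewrite lerD2l ler_wpM2l//; last exact: switch_constant_le.
  by rewrite subr_ge0 lef_pV2// posrE; exact: stepsize_gt0.
- by apply: auxiliary_gap_le; rewrite ?S1.
- by apply: expect_ge0 => w; rewrite subr_ge0.
- by move=> i iS; exact: stepsize_gt0.
Qed.

End run.

(** * Averaging over stages with geometric weights *)

(** In the increasing term [alpha ^+ t.-1] is replaced by [alpha ^+ N] and the weights sum to one.
    In the decreasing term the powers cancel against the weights, leaving [N] copies of [C / W],
    where [W] is at least its last summand [alpha ^+ N.-1]. *)
Lemma geometric_mixture_le (R : realFieldType) (alpha K C : R) (N : nat)
    (s : nat -> R) :
  (1 <= N)%N -> 1 < alpha -> 0 <= K -> 0 <= C ->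
  (forall t, (1 <= t <= N)%N -> s t <= K * alpha ^+ t.-1 + C / alpha ^+ t.-1) ->
  \sum_(1 <= t < N.+1)
    (alpha ^+ t.-1 / \sum_(1 <= l < N.+1) alpha ^+ l.-1) * s t <=
  K * alpha ^+ N + C * (N%:R / alpha ^+ N.-1).
Proof.
move=> N1 a1 K0 C0 hs; set W := \sum_(1 <= l < N.+1) alpha ^+ l.-1.
have a0 : 0 < alpha by exact: lt_trans a1.
have aW : alpha ^+ N.-1 <= W.
  by rewrite /W big_nat_recr//= lerDr sumr_ge0// => l _; rewrite exprn_ge0// ltW.
have W0 : 0 < W by apply: lt_le_trans aW; rewrite exprn_gt0.
apply: (@le_trans _ _ (\sum_(1 <= t < N.+1)
    ((alpha ^+ t.-1 / W) * (K * alpha ^+ N) + C / alpha ^+ N.-1))).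
  rewrite big_nat_cond [leRHS]big_nat_cond; apply: ler_sum => t.
  rewrite andbT ltnS => tN; have q0 : 0 < alpha ^+ t.-1 by rewrite exprn_gt0.
  apply: le_trans (ler_wpM2l _ (hs t tN)) _; first by rewrite divr_ge0// ltW.
  rewrite mulrDr lerD//.
    rewrite ler_wpM2l ?divr_ge0 ?(ltW q0) ?(ltW W0)// ler_wpM2l//.
    by rewrite ler_weXn2l ?(ltW a1)//; case/andP: tN => _;
      apply: leq_trans (leq_pred _).
  have -> : alpha ^+ t.-1 / W * (C / alpha ^+ t.-1) = C / W.
    by field; rewrite !gt_eqF.
  by rewrite ler_wpM2l// lef_pV2// posrE exprn_gt0.
rewrite big_split/= -mulr_suml -mulr_suml -/W mulfV ?gt_eqF// mul1r lerD2l.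
by rewrite sumr_const_nat subSS subn0 -[leLHS]mulr_natr mulrAC mulrA.
Qed.

(** Dividing [stage_bound] by the stage length gives the shape that [geometric_mixture_le] expects.
    Nonnegativity of [Delta0] is returned too, since the final comparison needs the signs of the
    constants. *)
Lemma sgdm_geometric_bound (R : realType) (d : nat) (disp : measure_display)
  (Omega : measurableType disp) (P : probability Omega R)
  (f : 'rV[R]_d -> R) (L fstar : R)
  (hf_diff : forall x, differentiable f x)
  (hL : 0 < L)
  (hf_lip : forall x y, l2norm (grad f x - grad f y) <= L * l2norm (x - y))
  (hfstar_le : forall x, fstar <= f x)
  (beta m M G Delta0 alpha : R) (delta : nat -> R)
  (T N : nat) (S : nat -> nat) (n : nat -> nat -> R) (x11 : 'rV[R]_d)
  (F : nat -> nat -> set (set Omega))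
  (x v g : nat -> nat -> Omega -> 'rV[R]_d)
  (tstar istar : {RV P >-> nat})
  (hrun : sgdm_run P f beta m M delta T N S n x11 F x v g)
  (hout : output_index delta N S (F N (S N).+1) tstar istar)
  (hG : forall t i, (1 <= t <= N)%N -> (1 <= i <= S t)%N ->
    ('E_P[fun w => (l2norm (g t i w) ^+ 2)%R] <= (G ^+ 2)%:E)%E)
  (hDelta0 : forall t i, (1 <= t <= N)%N -> (1 <= i <= S t)%N ->
    ('E_P[fun w => (f (x t i w) - fstar)%R] <= Delta0%:E)%E)
  (heta_decr : forall t i, (1 <= t <= N)%N -> (2 <= i <= S t)%N ->
    stepsize n delta t i <= stepsize n delta t i.-1)
  (heta_le : forall t i, (1 <= t <= N)%N -> (1 <= i <= S t)%N ->
    stepsize n delta t i <= 1 / L)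
  (hT : (1 <= T)%N) (hN : (1 <= N)%N)
  (halpha : 1 < alpha)
  (hdelta : forall t, (1 <= t <= N)%N -> delta t = 1 / alpha ^+ t.-1)
  (hS : forall t, (1 <= t <= N)%N -> (S t)%:R = T%:R / N%:R :> R) :
  0 <= Delta0 /\
  ('E_P[fun w => (l2norm (grad f (x (tstar w) (istar w) w)) ^+ 2)%R] <=
    (aux_gap_bound L beta G Delta0 / m * (N%:R * alpha ^+ N / T%:R)
     + M * (L * (beta / (1 - beta)) + L / 2) * G ^+ 2
       * (N%:R / alpha ^+ N.-1))%:E)%E.
Proof.
have T0 : 0 < T%:R :> R by rewrite ltr0n.
have N0 : 0 < N%:R :> R by rewrite ltr0n.
have a0 : 0 < alpha by exact: lt_trans halpha.
have /andP[b0 b1] := run_beta hrun; have /andP[m0 mM] := run_mM hrun.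
have S1 t : (1 <= t <= N)%N -> (1 <= S t)%N.
  by move=> tN; rewrite -(ltr0n R) hS// divr_gt0.
have t1 : (1 <= 1 <= N)%N by rewrite hN.
have i1 : (1 <= 1 <= S 1)%N by rewrite S1.
have D0 : 0 <= Delta0.
  exact: (gap_bound_ge0 hf_diff hfstar_le hrun hDelta0 t1 i1).
have Dz0 : 0 <= aux_gap_bound L beta G Delta0.
  have b1' : 0 <= 1 - beta by rewrite subr_ge0 ltW.
  apply: addr_ge0; apply: divr_ge0 => //.
    by rewrite mulr_ge0 ?sqr_ge0// ltW.
  by rewrite !mulr_ge0 ?sqr_ge0// ltW.
have B0 : 0 <= L * (beta / (1 - beta)) + L / 2.
  by rewrite addr_ge0 ?divr_ge0 ?(ltW hL)// mulr_ge0 ?(ltW hL)//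
    divr_ge0 ?(ltW b0)// subr_ge0 ltW.
split=> //.
have E_h : (fun w => l2norm (grad f (x (tstar w) (istar w) w)) ^+ 2) =
    (fun w => (fun t i w => dot (grad f (x t i w)) (grad f (x t i w)))
      (tstar w) (istar w) w).
  by apply/funext => w; rewrite sqr_l2norm.
rewrite E_h; have endN : (1 <= (S N).+1 <= (S N).+1)%N by rewrite leqnn.
have NN : (1 <= N <= N)%N by rewrite hN leqnn.
rewrite (output_expectation (filtration_sigma hrun NN endN)
  (filtration_measurable hrun NN endN) hout
  (h := fun t i w => dot (grad f (x t i w)) (grad f (x t i w)))); last first.
  move=> t i tN iS; split; last first.
    apply: (square_integrable_grad hf_diff hL hf_lip hfstar_le _ _).2.
      exact: (iterate_measurable hrun).
    exact: (iterate_gap hf_diff hfstar_le hrun hDelta0 tN iS).1.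
  have iS' : (1 <= i <= (S t).+1)%N by case/andP: iS => -> /leqW.
  have mg : vmeasurable_wrt (F t i) (fun w => grad f (x t i w)).
    move=> j; have cj := grad_coord_continuous hL hf_lip (j := j).
    apply: (measurable_wrt_continuous (filtration_sigma hrun tN iS') cj).
    exact: (rf_iterate (run_filtr hrun) tN iS).
  apply: (@subset_trans _ (F t i)); last exact: (filtration_end hrun).
  apply/measurable_wrtP; first exact: (filtration_sigma hrun).
  apply: measurable_dot; apply/vmeasurable_wrtP => //;
    exact: (filtration_sigma hrun).
rewrite lee_fin.
have probE t : (1 <= t <= N)%N -> stage_prob N delta t =
    alpha ^+ t.-1 / \sum_(1 <= l < N.+1) alpha ^+ l.-1.
  move=> tN; rewrite /stage_prob hdelta// div1r invrK; congr (_ / _).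
  by apply: eq_big_nat => l lN; rewrite hdelta// div1r invrK.
under eq_big_nat => t tN.
  rewrite -mulr_sumr probE// -mulrA.
  over.
apply: le_trans (geometric_mixture_le
  (K := aux_gap_bound L beta G Delta0 / m * (N%:R / T%:R))
  (C := M * (L * (beta / (1 - beta)) + L / 2) * G ^+ 2) hN halpha _ _ _) _.
- by rewrite mulr_ge0// divr_ge0// ltW.
- by rewrite mulr_ge0 ?sqr_ge0// mulr_ge0// (le_trans _ mM)// ltW.
- move=> t tN; have q0 : 0 < alpha ^+ t.-1 by rewrite exprn_gt0.
  have iS : (1 <= S t <= S t)%N by rewrite S1//=.
  have S0 : 0 < (S t)%:R :> R by rewrite ltr0n S1.
  have sb := stage_bound hf_diff hL hf_lip hfstar_le hrun hG hDelta0 heta_decr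
    heta_le tN (S1 t tN).
  apply: le_trans (ler_wpM2l _ sb) _; first by rewrite invr_ge0 ltW.
  rewrite mulrDr lerD//.
    rewrite hS// invf_div.
    have -> : aux_gap_bound L beta G Delta0 / m * (N%:R / T%:R) * alpha ^+ t.-1 =
      (N%:R / T%:R) * (aux_gap_bound L beta G Delta0 * (alpha ^+ t.-1 / m)) by ring.
    rewrite ler_wpM2l ?divr_ge0 ?ler0n// ler_wpM2l//.
    (* The lower edge of the band at the last iteration of the stage bounds [1 / eta t (S t)] by
       [alpha ^+ t.-1 / m]. *)
    have [md0 /andP[me _]] := stepsize_bounds hrun tN iS.
    apply: (@le_trans _ _ (m * delta t)^-1).
      by rewrite lef_pV2// posrE (lt_le_trans md0).
    by rewrite hdelta// div1r invfM invrK mulrC.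
  (* The upper edge of the band bounds the average step-size of the stage by [M / alpha ^+ t.-1]. *)
  have etaM : \sum_(1 <= i < (S t).+1) stepsize n delta t i <=
      (S t)%:R * (M / alpha ^+ t.-1).
    apply: (@le_trans _ _ (\sum_(1 <= i < (S t).+1) (M / alpha ^+ t.-1))).
      rewrite big_nat_cond [leRHS]big_nat_cond; apply: ler_sum => i.
      rewrite andbT ltnS => iS2.
      have [_ /andP[_]] := stepsize_bounds hrun tN iS2.
      by rewrite hdelta// div1r.
    by rewrite sumr_const_nat subSS subn0 mulr_natl.
  rewrite mulrCA; apply: (@le_trans _ _ ((L * (beta / (1 - beta)) + L / 2) *
      G ^+ 2 * ((S t)%:R^-1 * ((S t)%:R * (M / alpha ^+ t.-1))))).
    apply: ler_wpM2l; first by rewrite mulr_ge0 ?sqr_ge0.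
    by apply: ler_wpM2l; rewrite // invr_ge0 ltW.
  by rewrite mulKf ?gt_eqF// le_eqVlt; apply/orP; left; apply/eqP; ring.
by rewrite lerD2r le_eqVlt; apply/orP; left; apply/eqP; ring.
Qed.

(** * The stated bounds, for general and for logarithmic [N] *)

Theorem theorem4p2 (R : realType) (d : nat) (disp : measure_display)
  (Omega : measurableType disp) (P : probability Omega R)
  (f : 'rV[R]_d -> R) (L fstar : R)
  (hf_diff : forall x, differentiable f x)
  (hL : 0 < L)
  (hf_lip : forall x y, l2norm (grad f x - grad f y) <= L * l2norm (x - y))
  (hfstar_le : forall x, fstar <= f x)
  (hfstar_att : exists x, f x = fstar)
  (beta m M G Delta0 alpha eta01 : R) (delta : nat -> R)
  (T N : nat) (S : nat -> nat) (n : nat -> nat -> R) (x11 x01 : 'rV[R]_d)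
  (F : nat -> nat -> set (set Omega))
  (x v g : nat -> nat -> Omega -> 'rV[R]_d)
  (tstar istar : {RV P >-> nat})
  (hrun : sgdm_run P f beta m M delta T N S n x11 F x v g)
  (hout : output_index delta N S (F N (S N).+1) tstar istar)
  (heta01 : 0 < eta01)
  (hx01 : forall w, x11 = x01 - eta01 *: v 1%N 1%N w)
  (hG : forall t i, (1 <= t <= N)%N -> (1 <= i <= S t)%N ->
    ('E_P[fun w => (l2norm (g t i w) ^+ 2)%R] <= (G ^+ 2)%:E)%E)
  (hDelta0 : forall t i, (1 <= t <= N)%N -> (1 <= i <= S t)%N ->
    ('E_P[fun w => (f (x t i w) - fstar)%R] <= Delta0%:E)%E)
  (heta_decr : forall t i, (1 <= t <= N)%N -> (2 <= i <= S t)%N ->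
    stepsize n delta t i <= stepsize n delta t i.-1)
  (heta_le : forall t i, (1 <= t <= N)%N -> (1 <= i <= S t)%N ->
    stepsize n delta t i <= 1 / L)
  (hT : (1 <= T)%N) (hN : (1 <= N)%N)
  (halpha : 1 < alpha)
  (hdelta : forall t, (1 <= t <= N)%N -> delta t = 1 / alpha ^+ t.-1) :
  let r := beta * L / (2 * (1 - beta ^+ 2) * (1 - beta) ^+ 2) in
  let Deltaz := Delta0 / (1 - beta)
                + beta * G ^+ 2 / (2 * (1 - beta) ^+ 2 * L) in
  let A1 := beta * Delta0 / (1 - beta) + Deltaz + r * G ^+ 2 / L ^+ 2 in
  let A2 := 1 + beta / (2 * (1 - beta) ^+ 2) in
  let B1 := r * (1 - beta) * (2 - beta) + L / (2 * (1 - beta) ^+ 2) in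
  let C0 := r * (G ^+ 2 / L + 2 * Delta0) in
  let C1 := A1 + Deltaz + Delta0 / (1 - beta) in
  let C2 := C0 + A2 * G ^+ 2 in
  let W11 := Wfun f fstar beta r eta01 x01 x11 in
  let xhat := fun w => x (tstar w) (istar w) w in
  let Tr : R := T%:R in
  let Nr : R := N%:R in
  ((forall t, (1 <= t <= N)%N -> (S t)%:R = Tr / Nr) ->
   ('E_P[fun w => (l2norm (grad f (xhat w)) ^+ 2)%R] <=
     (W11 * Nr / (Tr * alpha ^+ N.-1)
      + (alpha * C0 + C2) * (Nr / Tr)
      + (Deltaz + C1) / m * (Nr * alpha ^+ N / Tr)
      + M * B1 * G ^+ 2 * (Nr / alpha ^+ N.-1))%:E)%E)
  /\
  (Nr = (ln Tr / ln alpha) / 2 ->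
   (forall t, (1 <= t <= N)%N -> (S t)%:R = 2 * Tr / (ln Tr / ln alpha)) ->
   ('E_P[fun w => (l2norm (grad f (xhat w)) ^+ 2)%R] <=
     (alpha * W11 / (2 * ln alpha) * (ln Tr / Tr `^ (3 / 2))
      + (alpha * C0 + C2) / (2 * ln alpha) * (ln Tr / Tr)
      + (Deltaz + C1) / (2 * m * ln alpha) * (ln Tr / Num.sqrt Tr)
      + alpha * M * B1 * G ^+ 2 / (2 * ln alpha) * (ln Tr / Num.sqrt Tr))%:E)%E).
Proof.
move=> r Deltaz A1 A2 B1 C0 C1 C2 W11 xhat Tr Nr.
have /andP[b0 b1] := run_beta hrun; have /andP[m0 mM] := run_mM hrun.
have b1' : 0 < 1 - beta by rewrite subr_gt0.
have T0 : 0 < Tr by rewrite ltr0n.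
have N0 : 0 < Nr by rewrite ltr0n.
have a0 : 0 < alpha by exact: lt_trans halpha.
have fixed_length : (forall t, (1 <= t <= N)%N -> (S t)%:R = Tr / Nr) ->
   ('E_P[fun w => (l2norm (grad f (xhat w)) ^+ 2)%R] <=
     (W11 * Nr / (Tr * alpha ^+ N.-1)
      + (alpha * C0 + C2) * (Nr / Tr)
      + (Deltaz + C1) / m * (Nr * alpha ^+ N / Tr)
      + M * B1 * G ^+ 2 * (Nr / alpha ^+ N.-1))%:E)%E.
  move=> hS.
  have [D0 h] := sgdm_geometric_bound hf_diff hL hf_lip hfstar_le hrun hout hG
    hDelta0 heta_decr heta_le hT hN halpha hdelta hS.
  apply: le_trans h _; rewrite lee_fin -/Tr -/Nr.
  have -> : aux_gap_bound L beta G Delta0 = Deltaz by [].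
  have r0 : 0 <= r.
    have bb : 0 < 1 - beta ^+ 2 by rewrite subr_gt0 expr_lt1// ltW.
    by apply: divr_ge0; rewrite !mulr_ge0 ?sqr_ge0// ltW.
  have Dz0 : 0 <= Deltaz.
    apply: addr_ge0; apply: divr_ge0 => //; first exact: ltW.
      by rewrite mulr_ge0 ?sqr_ge0// ltW.
    by rewrite !mulr_ge0 ?sqr_ge0// ltW.
  have A10 : 0 <= A1.
    apply: addr_ge0; first apply: addr_ge0 => //.
      by rewrite mulr_ge0// ?invr_ge0 ?(ltW b1')// mulr_ge0// ltW.
    by rewrite mulr_ge0// ?invr_ge0 ?sqr_ge0// mulr_ge0// sqr_ge0.
  have A20 : 0 <= A2.
    by rewrite /A2 addr_ge0// divr_ge0 ?(ltW b0)// mulr_ge0// sqr_ge0.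
  have C00 : 0 <= C0.
    apply: mulr_ge0 => //; apply: addr_ge0; last exact: mulr_ge0.
    by rewrite divr_ge0 ?sqr_ge0// ltW.
  have C10 : 0 <= C1.
    by rewrite /C1 addr_ge0 ?divr_ge0 ?(ltW b1')// addr_ge0.
  have C20 : 0 <= C2 by rewrite /C2 addr_ge0// mulr_ge0 ?sqr_ge0.
  have W0 : 0 <= W11.
    have gap0 y : 0 <= f y - fstar by rewrite subr_ge0.
    apply: addr_ge0; last by rewrite mulr_ge0// mulr_ge0.
    apply: addr_ge0; apply: divr_ge0; rewrite ?(ltW heta01)//.
    by rewrite mulr_ge0 ?sqr_ge0.
  (* The difference is a sum of nonnegative terms because [1 - 2 beta (1 - beta) - (1 - beta)^2 =
     beta^2]. *)
  have BB1 : L * (beta / (1 - beta)) + L / 2 <= B1.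
    rewrite -subr_ge0.
    have -> : B1 - (L * (beta / (1 - beta)) + L / 2) =
        r * (1 - beta) * (2 - beta) + L * beta ^+ 2 / (2 * (1 - beta) ^+ 2).
      by rewrite /B1; field; rewrite gt_eqF.
    have b2 : 0 <= 2 - beta by lra.
    apply: addr_ge0; last first.
      by apply: divr_ge0; rewrite mulr_ge0 ?sqr_ge0// ltW.
    by apply: mulr_ge0 => //; apply: mulr_ge0 => //; exact: ltW.
  have e1 : 0 <= W11 * Nr / (Tr * alpha ^+ N.-1).
    by rewrite divr_ge0 ?mulr_ge0 ?exprn_ge0 ?(ltW T0) ?(ltW N0) ?(ltW a0).
  have e2 : 0 <= (alpha * C0 + C2) * (Nr / Tr).
    by rewrite mulr_ge0 ?divr_ge0 ?(ltW T0) ?(ltW N0)// addr_ge0// mulr_ge0// ltW.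
  (* Term by term: the first two terms are nonnegative, the third only grows by adding [C1], and the
     fourth grows by [BB1]. *)
  rewrite lerD//.
    rewrite -[leLHS]add0r lerD ?addr_ge0//.
    apply: ler_wpM2r; first by rewrite divr_ge0 ?mulr_ge0 ?exprn_ge0// ltW.
    by rewrite ler_wpM2r ?invr_ge0 ?(ltW m0)// lerDl.
  apply: ler_wpM2r; first by rewrite divr_ge0 ?exprn_ge0// ltW.
  apply: ler_wpM2r; first exact: sqr_ge0.
  by apply: ler_wpM2l => //; exact: le_trans (ltW m0) mM.
split=> // hNlog hSlog.
have la0 : 0 < ln alpha by rewrite ln_gt0.
(* The choice of [N] says that [alpha^(2 N) = T], so [alpha ^+ N] is the square root of [T] and
   every power of [T] in the second claim is a power of it. *)
have aNsq : alpha ^+ N ^+ 2 = Tr.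
  apply: ln_inj; rewrite ?posrE ?exprn_gt0// !lnXn ?exprn_gt0//.
  rewrite -mulrnA -mulr_natr natrM -/Nr hNlog; field; rewrite gt_eqF//.
have aN0 : 0 < alpha ^+ N by rewrite exprn_gt0.
have sqrtT : Num.sqrt Tr = alpha ^+ N by rewrite -aNsq sqrtr_sqr gtr0_norm.
have powT : Tr `^ (3 / 2) = alpha ^+ N * Tr.
  rewrite -aNsq -powR_mulrn ?(ltW aN0)// -powRrM.
  have -> : 2%:R * (3 / 2) = 3%:R :> R by field.
  by rewrite !powR_mulrn ?(ltW aN0)// exprS.
(* This shift of exponent is the source of the additional factor [alpha] in the first and fourth
   terms. *)
have aNp : alpha ^+ N.-1 = alpha ^+ N / alpha.
  by rewrite -[in RHS](prednK hN) exprS mulrC mulKf// gt_eqF.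
have hlog : ln Tr = 2 * ln alpha * Nr by rewrite hNlog; field; rewrite gt_eqF.
have := fixed_length _; rewrite powT sqrtT hlog aNp => fixed_length'.
apply: le_trans (fixed_length' _) _.
  by move=> t tN; rewrite hSlog// hlog; field; rewrite !gt_eqF.
(* With this [N], the prescribed stage length is [T / N] and the two right-hand sides are equal. *)
rewrite lee_fin le_eqVlt; apply/orP; left; apply/eqP.
move: (alpha ^+ N) aNsq aN0 => s <- s0; field.
by rewrite !gt_eqF.
Qed.
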